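(* Let $G=AB$ be a finite group which is a mutually permutable product of its subgroups $A$ and $B$. Let $\Gamma(A,B)$ be the graph with vertex set $\pi(G)$ and edge set $\{(p,q)\mid p\in\pi(A),\ q\in\pi(B)\cap\pi(p-1)\ \text{ or }\ p\in\pi(B),\ q\in\pi(A)\cap\pi(p-1)\}$, and let $L$ be the graph with vertex set $\pi(G)$ and edge set $\{(p,p)\mid p\in\pi(G)\}$. Then $$\Gamma_{Nc}(A)\cup\Gamma_{Nc}(B)\subseteq\Gamma_{Nc}(G)\subseteq\Gamma_{Nc}(A)\cup\Gamma_{Nc}(B)\cup\Gamma(A,B)$$ and $$\Gamma_H(A)\cup\Gamma_H(B)\subseteq\Gamma_H(G)\subseteq\Gamma_H(A)\cup\Gamma_H(B)\cup\Gamma(A,B)\cup L.$$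
   Context: All groups are finite; $\pi(G)$ denotes the set of prime divisors of $|G|$, and $\pi(n)$ the set of prime divisors of an integer $n$. Graphs are directed: a graph consists of a vertex set and an edge set of ordered pairs of vertices; union takes unions of vertex and edge sets, and $\Gamma_1\subseteq\Gamma_2$ means inclusion of vertex sets and of edge sets. $O_{p',p}(G)$ is the largest normal $p$-nilpotent subgroup of $G$. The Hawkes graph $\Gamma_H(G)$ has vertex set $\pi(G)$ and an edge $(p,q)$ whenever $q\in\pi(G/O_{p',p}(G))$. A Schmidt group is a non-nilpotent group all of whose proper subgroups are nilpotent; a Schmidt $(p,q)$-group is a Schmidt group $S$ with $\pi(S)=\{p,q\}$ and a normal Sylow $p$-subgroup. The $N$-critical graph $\Gamma_{Nc}(G)$ has vertex set $\pi(G)$ and an edge $(p,q)$ whenever $G$ contains a Schmidt $(p,q)$-subgroup. $G$ is a mutually permutable product of subgroups $A$ and $B$ if $G=AB$, $A$ permutes with every subgroup of $B$, and $B$ permutes with every subgroup of $A$. *)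

(* Defs.v *)
From mathcomp Require Import all_boot all_fingroup all_solvable.
Set Implicit Arguments. Unset Strict Implicit. Unset Printing Implicit Defensive.
Local Open Scope group_scope.

Record graph := Graph { gV : nat -> Prop ; gE : nat -> nat -> Prop }.

Definition gunion (G1 G2 : graph) : graph :=
  Graph (fun p => gV G1 p \/ gV G2 p) (fun p q => gE G1 p q \/ gE G2 p q).

Definition gsub (G1 G2 : graph) : Prop :=
  (forall p, gV G1 p -> gV G2 p) /\ (forall p q, gE G1 p q -> gE G2 p q).

Definition mutually_permutable (gT : finGroupType) (G A B : {group gT}) : Prop :=
  [/\ A * B = G,
      (forall H : {group gT}, H \subset B -> A * H = H * A) &
      (forall H : {group gT}, H \subset A -> B * H = H * B)].

Definition schmidt (gT : finGroupType) (S : {group gT}) : Prop :=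
  ~~ nilpotent S /\ (forall H : {group gT}, H \proper S -> nilpotent H).

Definition schmidt_pq (gT : finGroupType) (p q : nat) (S : {group gT}) : Prop :=
  [/\ schmidt S,
      (forall r, (r \in \pi(S)) = (r == p) || (r == q)) &
      exists2 P : {group gT}, P \in 'Syl_p(S) & P <| S].

Definition GammaNc (gT : finGroupType) (G : {group gT}) : graph :=
  Graph (fun p => p \in \pi(G))
        (fun p q => exists2 S : {group gT}, S \subset G & schmidt_pq p q S).

(* Hawkes graph; 'O_{p^',p}(G) is the largest normal p-nilpotent subgroup. *)
Definition GammaH (gT : finGroupType) (G : {group gT}) : graph :=
  Graph (fun p => p \in \pi(G))
        (fun p q => (p \in \pi(G)) && (q \in \pi(G / 'O_{p^', p}(G)))).

Definition GammaAB (gT : finGroupType) (G A B : {group gT}) : graph :=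
  Graph (fun p => p \in \pi(G))
        (fun p q => [&& p \in \pi(A), q \in \pi(B) & q \in \pi(p.-1)]
                 || [&& p \in \pi(B), q \in \pi(A) & q \in \pi(p.-1)]).

Definition Lgraph (gT : finGroupType) (G : {group gT}) : graph :=
  Graph (fun p => p \in \pi(G)) (fun p q => (p \in \pi(G)) && (p == q)).

(* Main.v *)
(** For a minimal normal subgroup [N] of the mutually permutable product [G = AB], the subgroup
    [(N :&: A) * (N :&: B)] is normal in [G]. If it is trivial then [N] has prime order [p], and a
    [q]-element acting nontrivially on [N] forces [q] to divide [p - 1], which gives an edge of
    [Gamma(A, B)]. Otherwise [N] is itself the mutually permutable product of [N :&: A] and
    [N :&: B]; then [A] leaves invariant [(N :&: A) * Y] for every subgroup [Y] of [N :&: B].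
    If [(p, q)] is an edge of none of the graphs of the right-hand side, a chain of such subgroups
    of index [p] shows that all [q]-elements of [A], and similarly of [B], lie in [N * 'C_G(P)] for
    a Sylow [p]-subgroup [P] of [N]. By induction on [#|G|] no [q]-subgroup acts nontrivially on a
    [p]-subgroup of [G], which is the absence of Schmidt [(p, q)]-subgroups.

    For the Hawkes graph it is enough, again by induction, that the [q]-elements of [A] and [B]
    centralise [N] when [p] divides [#|N|]. For abelian [N] this is the previous argument. For
    nonabelian [N], a mutually permutable product that is simple equals one of its factors, so
    every simple factor [S] of [N] lies in [A] or in [B]: if [S] is in [A], it is centralised by
    ['O_p^'(A)], which contains the [q]-elements of [A]; if [S] is in [B] but not in [A], then [A]
    normalises every subgroup of [S] and hence centralises [S]. *)

Require Import Defs.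
From mathcomp Require Import all_boot all_fingroup all_solvable.
Set Implicit Arguments.
Unset Strict Implicit.
Unset Printing Implicit Defensive.
Local Open Scope group_scope.

(** * Coprime action *)

Section Coprime.

Variable gT : finGroupType.
Implicit Types (G H K R T : {group gT}).

(** Coprime action gives [R = [~: R, T] * 'C_R(T)], so only the action on [[~: R, T]] matters. *)
Lemma coprime_cent_comm R T :
    T \subset 'N(R) -> coprime #|R| #|T| -> solvable R ->
  T \subset 'C([~: R, T]) -> T \subset 'C(R).
Proof.
move=> nRT coRT solR cT.
have sRcR : [~: R, T] \subset R by rewrite commg_subl.
have defR : R / [~: R, T] = 'C_R(T) / [~: R, T].
  rewrite coprime_quotient_cent ?commg_normr //.
  by apply/esym/setIidPl; rewrite quotient_cents2r.
suff <- : [~: R, T] * 'C_R(T) = R by rewrite centM subsetI cT centsC subsetIr.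
apply/eqP; rewrite eqEsubset mul_subG ?subsetIl //=.
by rewrite -quotientSK ?commg_norml // defR.
Qed.

Lemma pq_coprime (p q : nat) R T : p != q -> p.-group R -> q.-group T -> coprime #|R| #|T|.
Proof.
move=> npq pR qT; apply: pnat_coprime pR _.
by apply: sub_in_pnat qT => r _ /eqnP->; rewrite !inE eq_sym.
Qed.

(** [T / 'C_T(R)] is a [q]-group embedded in the automorphism group of a cyclic group of order [p],
    which has order [p - 1]. *)
Lemma cent_prime_order (p q : nat) R T :
    #|R| = p -> prime p -> T \subset 'N(R) -> q.-group T -> ~~ (q \in \pi(p.-1)) ->
  T \subset 'C(R).
Proof.
move=> oR p_pr nRT qT q'p1.
have cycR : cyclic R by rewrite prime_cyclic ?oR.
have qTC : q.-group (T / 'C_T(R)) by exact: quotient_pgroup.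
have d : #|T / 'C_T(R)| %| p.-1.
  rewrite -ker_conj_aut (card_isog (first_isog_loc _ _)) //.
  apply: dvdn_trans (cardSg (Aut_conj_aut _ _)) _.
  by rewrite card_Aut_cyclic // oR totient_prime.
have T1 : T / 'C_T(R) = 1.
  apply/eqP; apply/idPn => ntQ.
  have [q_pr dq _] := pgroup_pdiv qTC ntQ.
  case/negP: q'p1; rewrite mem_primes q_pr (dvdn_trans dq d).
  by rewrite -ltnS prednK ?prime_gt0 // prime_gt1.
have nTC : T \subset 'N('C_T(R)) by rewrite normsI ?normG ?norms_cent.
have : T \subset 'C_T(R) by rewrite -quotient_sub1 // T1.
by rewrite subsetI => /andP[].
Qed.

End Coprime.

Section CoprimeIndex.

Variable gT : finGroupType.
Implicit Types (R T : {group gT}).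

(** A subgroup [R0] of index [p] is normal in [R] and [T] acts trivially on [R / R0], so [[~: R, T]]
    lies in [R0], where [T] acts trivially. *)
Lemma cent_index_p (p q : nat) R R0 T :
    p != q -> prime p -> R0 \subset R -> p.-group R -> #|R : R0| %| p ->
    q.-group T -> T \subset 'N(R) -> ~~ (q \in \pi(p.-1)) ->
  T \subset 'C(R0) -> T \subset 'C(R).
Proof.
move=> npq p_pr sR0 pR iR qT nRT q'p1 cR0.
have [_ pdv] := primeP p_pr.
case/orP: (pdv _ iR) => /eqP iR0.
  suff -> : R :=: R0 by [].
  by apply/eqP; rewrite eqEsubset sR0 andbT -indexg_eq1 iR0.
have maxR0 : maximal R0 R by apply: p_index_maximal => //; rewrite iR0.
have [_ nR0R] := andP (p_maximal_normal pR maxR0).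
have nR0T : T \subset 'N(R0) by rewrite cents_norm.
have cT : T / R0 \subset 'C(R / R0).
  apply: (@cent_prime_order _ p q) => //; last exact: quotient_pgroup.
    by rewrite card_quotient.
  exact: quotient_norms.
apply: coprime_cent_comm (pq_coprime npq pR qT) (pgroup_sol pR) _ => //.
have s: [~: R, T] \subset R0 by rewrite -quotient_cents2 // centsC.
exact: subset_trans cR0 (centS s).
Qed.

End CoprimeIndex.

(** * Mutually permutable products *)

Section Permutable.

Variable gT : finGroupType.
Implicit Types (G H K A B D M N X Y : {group gT}).

(** Take [M] maximal among the proper subgroups that contain [D] and permute with its conjugates. If
    [D :^ a] were not in [M], then [M * D :^ a = A]; writing [a = m * d] gives [D :^ a = D :^ m],
    which lies in [M]. So the normal closure of [D] is proper. *)
Lemma conj_permutable_sub_normal A D :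
    D \proper A -> {in A, forall a, commute D (D :^ a)} ->
  exists M : {group gT}, [/\ D \subset M, M \proper A & M <| A].
Proof.
move=> ltDA permD.
pose P (M : {group gT}) := [&& D \subset M, M \proper A &
                             [forall a in A, M * (D :^ a) == (D :^ a) * M]].
have PD : P D.
  by rewrite /P subxx ltDA; apply/forall_inP=> a Aa; apply/eqP; exact: permD.
have [M /maxgroupP[/and3P[sDM ltMA /forall_inP permM] maxM] _] := maxgroup_exists PD.
have sMA := proper_sub ltMA; have sDA := proper_sub ltDA.
have sDaM : {in A, forall a, D :^ a \subset M}.
  move=> a Aa; apply/idPn => nsDaM.
  have cMD : commute M (D :^ a) by apply/eqP/permM.
  pose MD := (M <*> (D :^ a))%G.
  have eMD : MD :=: M * D :^ a by rewrite /= comm_joingE.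
  have sMDA : MD \subset A by rewrite join_subG sMA conj_subG.
  have permMD : [forall b in A, MD * (D :^ b) == (D :^ b) * MD].
    apply/forall_inP=> b Ab; rewrite eMD.
    have cDab : commute (D :^ a) (D :^ b).
      have := permD (b * a^-1) (groupM Ab (groupVr Aa)).
      by move/(congr1 (conjugate^~ a)); rewrite !conjsMg -conjsgM mulgKV.
    rewrite -mulgA cDab mulgA (eqP (permM b Ab)) mulgA //.
  have [ltMDA | eqMDA] := boolP (MD \proper A).
    case/negP: nsDaM; rewrite -(maxM MD) ?joing_subr ?joing_subl //.
    by rewrite /P ltMDA permMD (subset_trans sDM) ?joing_subl.
  have defA : M * D :^ a = A.
    by rewrite -eMD; apply/eqP; move: eqMDA; rewrite properEneq sMDA andbT negbK.
  have : a \in M * D :^ a by rewrite defA.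
  case/mulsgP => m d Mm Dd def_a.
  case/negP: nsDaM.
  have -> : D :^ a = D :^ m.
    by rewrite -(conjGid (groupVr Dd)) /= -conjsgM def_a mulgK.
  exact: conj_subG.
exists <<class_support D A>>%G.
have sLM : <<class_support D A>> \subset M.
  rewrite gen_subG class_supportEr; apply/bigcupsP=> a Aa; exact: sDaM.
have sDL : D \subset <<class_support D A>>.
  by rewrite sub_gen // class_supportEr (bigcup_max 1) ?group1 ?conjsg1.
split=> //; first exact: sub_proper_trans sLM ltMA.
by rewrite /normal (subset_trans sLM) //= norms_gen ?class_support_norm.
Qed.

Lemma commute_setI A H N : commute A H -> H \subset N -> commute (N :&: A) H.
Proof.
move=> cAH sHN; rewrite /commute group_modr // cAH.
by rewrite [N :&: A]setIC group_modl // setIC.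
Qed.

Lemma mutperm_sym G A B : mutually_permutable G A B -> mutually_permutable G B A.
Proof.
case=> defG pA pB; split=> //; rewrite -{}defG.
by apply/esym; apply: pA.
Qed.

Lemma mutperm_sub G A B : mutually_permutable G A B -> A \subset G /\ B \subset G.
Proof. by case=> <- _ _; rewrite mulG_subl mulG_subr. Qed.

Lemma mutperm_commutel G A B X :
  mutually_permutable G A B -> X \subset A -> commute X B.
Proof. by case=> _ _ pB /pB. Qed.

Lemma mutperm_commuter G A B Y :
  mutually_permutable G A B -> Y \subset B -> commute A Y.
Proof. by case=> _ pA _ /pA. Qed.

Lemma mutperm_setI_commute G A B N :
  mutually_permutable G A B -> commute (N :&: A) (N :&: B).
Proof.
by move=> mp; apply/commute_setI/subsetIl/(mutperm_commuter mp)/subsetIr.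
Qed.

Lemma mutperm_setI G A B N :
    mutually_permutable G A B -> (N :&: A) * (N :&: B) = N ->
  mutually_permutable N (N :&: A) (N :&: B).
Proof.
move=> mp defN; split=> // H; rewrite subsetI => /andP[sHN sH].
  by apply/commute_setI/sHN/(mutperm_commuter mp).
by apply/commute_setI/sHN/esym/(mutperm_commutel mp).
Qed.

(** By Dedekind's law the product is the intersection of [N] with the group [A * (N :&: B)], which
    contains [A]. *)
Lemma mutperm_setI_norml G A B N :
    mutually_permutable G A B -> N <| G ->
  A \subset 'N((N :&: A) * (N :&: B)).
Proof.
move=> mp nsNG; have [sAG sBG] := mutperm_sub mp.
have cANB : commute A (N :&: B) by apply: mutperm_commuter mp (subsetIr _ _).
have eK := comm_joingE cANB; set K := A <*> _ in eK.
have sKG : K \subset G by rewrite join_subG sAG subIset // sBG orbT.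
have -> : (N :&: A) * (N :&: B) = N :&: K by rewrite eK group_modr ?subsetIl.
apply: subset_trans (_ : K \subset _); first exact: joing_subl.
by rewrite normsI ?normG // (subset_trans sKG) ?normal_norm.
Qed.

Lemma mutperm_setI_normal G A B N :
    mutually_permutable G A B -> N <| G ->
  G \subset 'N((N :&: A) * (N :&: B)).
Proof.
move=> mp nsNG; case: (mp) => <- _ _; rewrite mul_subG //.
  exact: mutperm_setI_norml mp nsNG.
rewrite (mutperm_setI_commute N mp).
exact: mutperm_setI_norml (mutperm_sym mp) nsNG.
Qed.

Lemma mutperm_minnormal G A B N :
    mutually_permutable G A B -> minnormal N G -> N \subset G ->
  (N :&: A = 1 /\ N :&: B = 1) \/ (N :&: A) * (N :&: B) = N.
Proof.
move=> mp /mingroupP[/andP[ntN nNG] minN] sNG.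
have nsNG : N <| G by apply/andP.
have e := comm_joingE (mutperm_setI_commute N mp).
have [tr | ntM] := eqVneq ((N :&: A) * (N :&: B)) 1.
  left; split; apply/trivgP; rewrite -tr; [exact: mulG_subl | exact: mulG_subr].
right; rewrite -e; apply: minN; last by rewrite join_subG !subsetIl.
by rewrite /= e ntM mutperm_setI_normal.
Qed.

(** The index is that of [<[x]> :&: B] in [<[x]>], and this intersection contains [<[x ^+ r]>], of
    index [gcdn #[x] r]. *)
Lemma mutperm_index_dvd G A B x r :
    mutually_permutable G A B -> x \in A -> x ^+ r \in B ->
  #|<[x]> <*> B : B| %| r.
Proof.
move=> mp Ax Br; have sxA : <[x]> \subset A by rewrite cycle_subG.
rewrite comm_joingE; last exact: mutperm_commutel mp sxA.
have -> : #|<[x]> * B : B| = #|<[x]> : B|.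
  by rewrite (mutperm_commutel mp sxA) indexMg.
rewrite -indexgI; apply: dvdn_trans (_ : #|<[x]> : <[x ^+ r]>| %| _).
  by apply: indexgS; rewrite subsetI cycleX cycle_subG.
rewrite -divgS ?cycleX // -!orderE orderXgcd.
have o_gt0 : 0 < #[x] %/ gcdn #[x] r by rewrite -orderXgcd order_gt0.
by rewrite -{1}(divnK (dvdn_gcdl #[x] r)) mulKn // dvdn_gcdr.
Qed.

(** With [H = <[x]> <*> B], the group [N :&: H] meets [B] trivially, so its order is the index of
    [B] in [(N :&: H) * B], a divisor of [#|H : B|]. *)
Lemma mutperm_index_card G A B N x r :
    mutually_permutable G A B -> x \in A -> x ^+ r \in B -> N <| G -> N :&: B = 1 ->
  #|N :&: (<[x]> <*> B)| %| r.
Proof.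
move=> mp Ax Br nsNG tiNB; apply: dvdn_trans (mutperm_index_dvd mp Ax Br).
set H := <[x]> <*> B; have [sAG sBG] := mutperm_sub mp.
have sHG : H \subset G by rewrite join_subG cycle_subG (subsetP sAG) ?sBG.
have sBH : B \subset H by exact: joing_subr.
rewrite -(indexg1 (N :&: H)).
have <- : (N :&: H) :&: B = 1 by rewrite -setIA (setIidPr sBH).
rewrite indexgI /= -(mul1n #|_ : B|) -(muln1 #|H : B|).
have nNB : B \subset 'N(N :&: H).
  rewrite normsI ?(subset_trans sBG (normal_norm nsNG)) //.
  exact: subset_trans sBH (normG _).
have <- : #|(N :&: H) <*> B : B| = #|N :&: H : B|.
  by rewrite norm_joinEr // -(normC nNB) indexMg.
by rewrite muln1 mul1n indexSg ?joing_subr // join_subG subsetIr.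
Qed.

(* Choose [x] of minimal order in [(A :&: N * B) :\: B] and write [x = n b]: then [x] and [b] have
   the same [r]-th power, and [N :&: <x>B] and [N :&: <b>A] are both the group of prime order
   [r] generated by [n]. *)
Lemma mutperm_minnormal_prime G A B N :
    mutually_permutable G A B -> minnormal N G -> N \subset G ->
    N :&: A = 1 -> N :&: B = 1 ->
  prime #|N|.
Proof.
move=> mp minN sNG tiNA tiNB; have [sAG sBG] := mutperm_sub mp.
have [/andP[ntN nNG] minN'] := mingroupP minN.
have nsNG : N <| G by apply/andP.
have nBN : B \subset 'N(N) := subset_trans sBG nNG.
have [n0 Nn0 nt_n0] := trivgPn _ ntN.
have : n0 \in B * A by case: (mutperm_sym mp) => -> _ _; apply: subsetP Nn0.
case/mulsgP=> b0 x0 Bb0 Ax0 def_n0.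
pose P x := [&& x \in A, x \in N <*> B & x \notin B].
have Px0 : P x0.
  have def_x0 : x0 = b0^-1 * n0 by rewrite def_n0 mulKg.
  rewrite /P Ax0 {1}def_x0 groupM ?mem_gen ?inE ?groupV ?Bb0 ?Nn0 ?orbT //=.
  apply: contra nt_n0 => Bx0; rewrite -in_set1 -set1gE -tiNB inE Nn0 def_n0.
  by rewrite groupM.
case: (arg_minnP (fun x : gT => #[x]) Px0) => x /and3P[Ax NBx nBx] minx.
have ntx : x != 1 by apply: contraNneq nBx => ->.
pose r := pdiv #[x].
have r_pr : prime r by rewrite pdiv_prime // ltn_neqAle eq_sym order_eq1 ntx order_gt0.
have r_dv : r %| #[x] by exact: pdiv_dvd.
have Bxr : x ^+ r \in B.
  apply/idPn => nBxr; have := minx (x ^+ r).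
  rewrite /P groupX // groupX // nBxr => /(_ isT).
  by rewrite leqNgt orderXdiv // ltn_Pdiv ?prime_gt1.
have [_ r_dvP] := primeP r_pr.
set H := <[x]> <*> B.
have oNH : #|N :&: H| %| r by exact: mutperm_index_card mp Ax Bxr nsNG tiNB.
rewrite norm_joinEr // in NBx; case/mulsgP: NBx => n b Nn Bb def_x.
have def_n : n = x * b^-1 by rewrite def_x mulgK.
have def_b : b = n^-1 * x by rewrite def_x mulKg.
have Hx : x \in H by rewrite mem_gen // inE cycle_id.
have HB : B \subset H by exact: joing_subr.
have NHn : n \in N :&: H by rewrite inE Nn def_n groupM // groupV (subsetP HB).
have nt_n : n != 1 by apply: contraNneq nBx => n1; rewrite def_x n1 mul1g.
have gen_n (L : {group gT}) : n \in L -> #|L| %| r -> L :=: <[n]>.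
  move=> Ln /r_dvP/orP[/eqP/card1_trivg L1 | /eqP oL].
    by case/negP: nt_n; rewrite -in_set1 -set1gE -L1.
  apply/esym/eqP; rewrite eqEcard cycle_subG Ln /= oL dvdn_leq ?order_gt0 //.
  have nt_o : #[n] != 1%N by rewrite order_eq1.
  have /r_dvP : #[n] %| r by rewrite -oL order_dvdG.
  by rewrite orderE in nt_o *; rewrite (negPf nt_o) => /eqP->.
have NHc : N :&: H = <[n]> by exact: (gen_n (N :&: H)%G).
have sHG : H \subset G by rewrite join_subG cycle_subG (subsetP sAG) ?sBG.
have nnH : H \subset 'N(<[n]>).
  by rewrite -NHc normsI ?normG // (subset_trans sHG).
have nnB : B \subset 'N(<[n]>) := subset_trans HB nnH.
have nnx : x \in 'N(<[n]>) by apply: (subsetP nnH).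
(* [b] and [x] normalise [<[n]>] and coincide modulo it, so [b ^+ r * (x ^+ r)^-1] lies in
   [N :&: B = 1]. *)
have Abr : b ^+ r \in A.
  have : b ^+ r * (x ^+ r)^-1 \in N :&: B.
    rewrite inE andbC groupM ?groupX ?groupV //=.
    have nn_b : b \in 'N(<[n]>) by apply: (subsetP nnB).
    have sn : <[n]> \subset N by rewrite cycle_subG.
    apply: (subsetP sn); apply: coset_idr; first by rewrite groupM ?groupV ?groupX.
    have eq_bx : coset <[n]> b = coset <[n]> x.
      by rewrite def_b coset_kerl // groupV cycle_id.
    by rewrite morphM ?groupV ?groupX // morphV ?groupX // !morphX //= eq_bx mulgV.
  rewrite tiNB => /set1gP/(canRL (mulgK _)).
  by rewrite mul1g invgK => ->; rewrite groupX.
have mp' := mutperm_sym mp.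
have oNH' : #|N :&: (<[b]> <*> A)| %| r by exact: mutperm_index_card mp' Bb Abr nsNG tiNA.
set H' := <[b]> <*> A in oNH'.
have sAH' : A \subset H' by exact: joing_subr.
have NHn' : n \in N :&: H'.
  have Hb : b \in H' by rewrite mem_gen // inE cycle_id.
  by rewrite inE Nn def_n groupM ?groupV // (subsetP sAH').
have NHc' : N :&: H' = <[n]> by exact: (gen_n (N :&: H')%G).
have sHG' : H' \subset G by rewrite join_subG cycle_subG (subsetP sBG) ?sAG.
have nnA : A \subset 'N(<[n]>).
  by rewrite -NHc' normsI ?(subset_trans sAH') ?normG // (subset_trans sHG').
have defN : <[n]> = N.
  apply: minN'; last by rewrite cycle_subG.
  by rewrite cycle_eq1 nt_n; case: mp => <- _ _; rewrite mul_subG.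
rewrite -defN -NHc; case/r_dvP/orP: oNH => /eqP oNH; last by rewrite oNH.
by case/negP: nt_n; rewrite -cycle_eq1 -NHc; apply/eqP/card1_trivg.
Qed.

(** As [G = B * A] and [B] normalises [M], the normal closure of [M] lies in the group [A * M]. Were
    it [G], Dedekind's law would give [B = (A :&: B) * M = M]. *)
Lemma mutperm_normal_sub G A B M :
    mutually_permutable G A B -> simple G -> A :&: B \subset M -> M <| B ->
    M \proper B -> 
  M :=: 1.
Proof.
move=> mp /simpleP[ntG simG] sDM nsMB ltMB; have [sAG sBG] := mutperm_sub mp.
have [sMB nMB] := andP nsMB.
have eAM := comm_joingE (mutperm_commuter mp sMB).
pose L := <<class_support M G>>%G.
have sLAM : L \subset A <*> M.
  rewrite gen_subG class_supportEr; apply/bigcupsP=> g.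
  case: (mutperm_sym mp) => <- _ _ /mulsgP[b a Bb Aa ->].
  rewrite conjsgM (normsP nMB) // conj_subG ?joing_subr //.
  by rewrite mem_gen // inE Aa.
have sAMG : A <*> M \subset G by rewrite join_subG sAG (subset_trans sMB).
have nsLG : L <| G.
  rewrite /normal (subset_trans sLAM) //= norms_gen ?class_support_norm //.
have sML : M \subset L.
  by rewrite sub_gen // class_supportEr (bigcup_max 1) ?group1 ?conjsg1.
case: (simG _ nsLG) => [L1 | LG]; first by apply/trivgP; rewrite -L1.
case/negP: (proper_subn ltMB).
have : B \subset B :&: A * M by rewrite subsetI subxx -eAM (subset_trans sBG) -?LG.
by rewrite -group_modr // setIC mulSGid.
Qed.

(** If [h] does not normalise [B], then [B :&: B :^ h] has index at least [pdiv #|G|] in [B], so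
    counting gives [B * B :^ h = H]; but [h] in [B * B :^ h] forces [h] into [B]. *)
Lemma index_pdiv_normal G H B :
    H \subset G -> B \subset H -> #|H : B| %| pdiv #|G| -> H \subset 'N(B).
Proof.
move=> sHG sBH iHB; apply/subsetP=> h Hh; rewrite inE; apply/idPn => nBh.
set r := pdiv #|G| in iHB.
have sBhH : B :^ h \subset H by rewrite conj_subG.
have nt_m : 1 < #|B : B :&: B :^ h|.
  rewrite indexg_gt1; apply: contra nBh; rewrite subsetI subxx /= => sBBh.
  by rewrite -(eqP (_ : B :==: B :^ h)) // eqEcard sBBh cardJg /=.
have m_dv : #|B : B :&: B :^ h| %| #|G|.
  exact: dvdn_trans (dvdn_indexg _ _) (cardSg (subset_trans sBH sHG)).
have r_le : r <= #|B : B :&: B :^ h| by exact: pdiv_min_dvd.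
have oBB : #|B * B :^ h| = (#|B| * #|B : B :&: B :^ h|)%N.
  apply/eqP; rewrite -(eqn_pmul2r (cardG_gt0 (B :&: B :^ h))).
  by rewrite -mul_cardG cardJg -mulnA [(#|B : _| * _)%N]mulnC Lagrange ?subsetIl.
have defH : B * B :^ h = H.
  apply/eqP; rewrite eqEcard mul_subG //= oBB -(Lagrange sBH) leq_mul2l.
  by rewrite (leq_trans _ r_le) ?orbT // dvdn_leq ?pdiv_gt0.
have : h \in B * B :^ h by rewrite defH.
case/mulsgP=> b c Bb /imsetP[d Bd ->] def_h.
case/negP: nBh; suff Bh : h \in B by rewrite conjGid.
have e : b * h^-1 * d = 1.
  by apply: (mulIg h); rewrite mul1g [RHS]def_h conjgE !mulgA.
have <- : d * (b * h^-1 * d)^-1 * b = h.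
  by rewrite !invMg invgK !mulgA mulgV mul1g mulgKV.
by rewrite e invg1 mulg1 groupM.
Qed.

Lemma mutperm_simple_norm G A B :
    mutually_permutable G A B -> simple A -> pdiv #|G| %| #|A| -> 1 < #|G| ->
  A \subset 'N(B).
Proof.
move=> mp /simpleP[ntA simA] rA G_gt1; have [sAG sBG] := mutperm_sub mp.
have r_pr : prime (pdiv #|G|) by rewrite pdiv_prime.
set r := pdiv #|G| in rA r_pr.
pose L := <<[set a in A | #[a] == r]>>%G.
have sLA : L \subset A by rewrite gen_subG; apply/subsetP=> a; rewrite inE => /andP[].
have nLA : L <| A.
  rewrite /normal sLA norms_gen //; apply/subsetP=> a Aa; rewrite inE.
  by apply/subsetP=> _ /imsetP[b + ->]; rewrite !inE orderJ memJ_norm // (subsetP (normG A)).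
have sLN : L \subset 'N(B).
  rewrite gen_subG; apply/subsetP=> a; rewrite inE => /andP[Aa /eqP oa].
  have sH : <[a]> <*> B \subset 'N(B).
    apply: (@index_pdiv_normal G); rewrite ?joing_subr //.
      by rewrite join_subG cycle_subG (subsetP sAG).
    by apply: mutperm_index_dvd mp Aa _; rewrite -/r -oa expg_order.
  by rewrite (subsetP sH) // mem_gen // inE cycle_id.
have [a Aa oa] := Cauchy r_pr rA.
case: (simA _ nLA) => [L1 | <- //].
have : a \in L by rewrite mem_gen // inE Aa oa /=.
by rewrite L1 => /set1gP a1; rewrite a1 order1 in oa; rewrite -oa in r_pr.
Qed.

(* Both factors turn out simple with trivial intersection; if the smallest prime divisor [r]
   of [#|G|] divides [#|A|], elements of order [r] of [A] normalise [B], since [B] has index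
   at most [r] in [<a>B]. *)
Lemma mutperm_simple G A B :
  mutually_permutable G A B -> simple G -> A :=: G \/ B :=: G.
Proof.
move=> mp simG; have [ntG normG1] := elimT (simpleP _) simG; have [sAG sBG] := mutperm_sub mp.
have [-> | neqAG] := eqVneq (A : {set gT}) G; first by left.
have [-> | neqBG] := eqVneq (B : {set gT}) G; first by right.
have aux (A' B' : {group gT}) : mutually_permutable G A' B' -> B' != G :> {set gT} ->
  A' != G :> {set gT} -> A' :&: B' = 1 /\ simple B'.
- move=> mp' neqB' neqA'; have [defG pA pB] := mp'.
  have ltD : A' :&: B' \proper B'.
    rewrite properEneq subsetIr andbT; apply: contraNneq neqA' => D_B.
    by rewrite -defG mulGSid // -D_B subsetIl.
  (* Conjugates of [A' :&: B'] under [B'] stay in [B'], so they permute with [A'] and, by Dedekind's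
     law, with [A' :&: B']. *)
  have [M [sDM ltM nsM]] : exists M : {group gT}, [/\ A' :&: B' \subset M, M \proper B' & M <| B'].
    apply: conj_permutable_sub_normal => // b Bb.
    have cAD: commute A' ((A' :&: B') :^ b).
      by apply: pA; rewrite conj_subG // subsetIr.
    rewrite [X in commute X _]setIC.
    by apply: commute_setI; rewrite // conj_subG // subsetIr.
  have D1 : A' :&: B' = 1.
    by apply/trivgP; rewrite -(mutperm_normal_sub mp' simG sDM nsM ltM).
  split=> //; apply/simpleP; split=> [|H nsH].
    by apply: contraNneq neqA' => B1; rewrite -defG B1 mulg1.
  have [-> | neqH] := eqVneq (H : {set gT}) B'; [by right | left].
  apply: (mutperm_normal_sub mp' simG _ nsH); first by rewrite D1 sub1G.
  by rewrite properEneq neqH (normal_sub nsH).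
have mp' := mutperm_sym mp.
have [tiAB simB] := aux _ _ mp neqBG neqAG; have [_ simA] := aux _ _ mp' neqAG neqBG.
have G_gt1 : 1 < #|G| by rewrite cardG_gt1.
have final A' B' : mutually_permutable G A' B' -> simple A' -> B' != G :> {set gT} ->
  A' != G :> {set gT} -> pdiv #|G| %| #|A'| -> False.
- move=> mp1 simA' nB nA rA; have nAB := mutperm_simple_norm mp1 simA' rA G_gt1.
  have [defG _ _] := mp1; have [sA' sB'] := mutperm_sub mp1.
  have nsB : B' <| G by rewrite /normal sB' -defG mul_subG ?normG.
  case: (normG1 _ nsB) => eB; last by rewrite eB eqxx in nB.
  by rewrite -defG eB mulg1 eqxx in nA.
have : pdiv #|G| %| #|A| * #|B|.
  by case: (mp) => defG _ _; rewrite mul_cardG defG dvdn_mulr // pdiv_dvd.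
rewrite Euclid_dvdM ?pdiv_prime // => /orP[rA | rB].
  by case: (final A B).
by case: (final B A).
Qed.

End Permutable.

(** * Quotients of mutually permutable products *)

Section Quotient.

Variable gT : finGroupType.
Implicit Types (G A B N : {group gT}).

Lemma mutperm_quotient G A B N :
  mutually_permutable G A B -> N <| G -> mutually_permutable (G / N) (A / N) (B / N).
Proof.
move=> mp nsNG; have [sAG sBG] := mutperm_sub mp; have [sNG nNG] := andP nsNG.
have [defG pA pB] := mp.
have nNA := subset_trans sAG nNG; have nNB := subset_trans sBG nNG.
have lift (X : {group gT}) (H : {group coset_of N}) : X \subset 'N(N) -> H \subset X / N ->
  exists2 H1 : {group gT}, H1 \subset X & H :=: H1 / N.
- move=> nNX sHX; exists (X :&: coset N @*^-1 H)%G; first exact: subsetIl.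
  apply/eqP; rewrite eqEsubset; apply/andP; split; apply/subsetP=> y.
    move=> Hy; have /morphimP[x Nx Xx def_y] := subsetP sHX y Hy.
    by rewrite def_y mem_quotient // inE Xx mem_morphpre //= -def_y.
  by case/morphimP=> x Nx /setIP[_ /morphpreP[_ Hx]] ->.
split; first by rewrite -quotientMl // defG.
- move=> H /(lift _ _ nNB)[H1 sH1 ->].
  by rewrite -quotientMl // pA // quotientMl // (subset_trans sH1).
move=> H /(lift _ _ nNA)[H1 sH1 ->].
by rewrite -quotientMl // pB // quotientMl // (subset_trans sH1).
Qed.

End Quotient.

(** * Actions of q-subgroups on p-subgroups *)

(* For [p != q], this fails exactly when [G] has a Schmidt [(p, q)]-subgroup: take a minimal
   non-nilpotent subgroup of [R <*> T]. *)
Definition inert (gT : finGroupType) (p q : nat) (G : {group gT}) : bool :=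
  [forall R : {group gT}, forall T : {group gT},
    [&& R \subset G, T \subset G, p.-group R, q.-group T & T \subset 'N(R)] ==>
    (T \subset 'C(R))].

(** One of the two symmetric clauses of the edge relation of [GammaAB], kept apart because the
    action of each factor involves only one of them. *)
Definition ab_edge (gT : finGroupType) (p q : nat) (A B : {group gT}) : bool :=
  [&& p \in \pi(A), q \in \pi(B) & q \in \pi(p.-1)].

Section Inert.

Variables (gT : finGroupType) (p q : nat).
Implicit Types (A B G H K N P R T : {group gT}).

Lemma inertP G :
  reflect (forall R T, R \subset G -> T \subset G -> p.-group R -> q.-group T ->
             T \subset 'N(R) -> T \subset 'C(R))
          (inert p q G).
Proof.
apply: (iffP forallP) => [inG R T sR sT pR qT nRT | inG R].
  by move/forallP/(_ T)/implyP: (inG R); apply; apply/and5P.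
by apply/forallP=> T; apply/implyP=> /and5P[]; apply: inG.
Qed.

Lemma inertS H G : H \subset G -> inert p q G -> inert p q H.
Proof.
move=> sHG /inertP inG; apply/inertP=> R T sR sT.
by apply: inG; apply: subset_trans sHG.
Qed.

(** Lift [Rb] and [Tb] to preimages [R] and [T1] in [G]. A Sylow [p]-subgroup [P] of [R] covers
    [Rb]. By the Frattini argument in [M = T1 <*> R], a Sylow [q]-subgroup of ['N_M(P)], which
    centralises [P], covers a Sylow [q]-subgroup of [M / K]; a conjugate of the latter contains
    [Tb]. *)
Lemma inert_quotient G K : G \subset 'N(K) -> inert p q G -> inert p q (G / K).
Proof.
move=> nKG /inertP inG.
apply/forallP=> Rb; apply/forallP=> Tb; apply/implyP=> /and5P[sRb sTb pR qT nRT].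
pose R := (G :&: coset K @*^-1 Rb)%G; pose T1 := (G :&: coset K @*^-1 Tb)%G.
have defR : Rb :=: R / K by rewrite /quotient morphim_setIpre; apply/esym/setIidPr.
have defT : Tb :=: T1 / K by rewrite /quotient morphim_setIpre; apply/esym/setIidPr.
have sRG : R \subset G by exact: subsetIl.
have sTG : T1 \subset G by exact: subsetIl.
have nKR := subset_trans sRG nKG; have nKT := subset_trans sTG nKG.
have nRT1 : T1 \subset 'N(R).
  rewrite normsI //; first exact: subset_trans sTG (normG _).
  apply: subset_trans (subsetIr _ _) _; apply: subset_trans (morphpre_norm _ _).
  exact: morphpreS.
pose M := (T1 <*> R)%G.
have sMG : M \subset G by rewrite join_subG sTG.
have nsRM : R <| M.
  by rewrite /normal joing_subr join_subG nRT1 normG.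
have [P sylP] := Sylow_exists p R; have sPR := pHall_sub sylP.
have defM := Frattini_arg nsRM sylP.
have [T2 sylT2] := Sylow_exists q 'N_M(P).
have [sT2 qT2 _] := and3P sylT2.
have cPT2 : T2 \subset 'C(P).
  have [sT2M sT2N] := subsetIP sT2.
  apply: inG => //; [exact: subset_trans sRG | exact: subset_trans sMG | ].
  exact: pHall_pgroup sylP.
have nKM := subset_trans sMG nKG.
have eRP : R / K = P / K.
  have sylPK : p.-Sylow(R / K) (P / K).
    by apply: quotient_pHall sylP; apply: subset_trans sPR nKR.
  apply: (sub_pHall sylPK) => //; [by rewrite /= -defR | exact: quotientS].
have sylT2K : q.-Sylow(M / K) (T2 / K).
  have -> : M / K = 'N_M(P) / K.
    rewrite -{1}defM quotientMl // eRP -quotientMl ?(subset_trans sPR) //.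
    rewrite mulSGid // subsetI normG andbT.
    exact: subset_trans sPR (joing_subr _ _).
  apply: quotient_pHall sylT2.
  by apply: subset_trans sT2 _; apply: subset_trans nKM; apply: subsetIl.
have sTM : Tb \subset M / K by rewrite defT quotientS // joing_subl.
have [y My sTy] := Sylow_subJ sylT2K sTM qT.
apply: subset_trans sTy _.
have nRy : y \in 'N(Rb).
  by apply: subsetP My; rewrite defR quotient_norms // normal_norm.
rewrite -(normP nRy) centJ conjSg defR eRP.
exact: quotient_cents.
Qed.

End Inert.

Section QuotientPrime.

Variables (gT : finGroupType) (p : nat).
Implicit Types (C G T : {group gT}).

Lemma Sylow_sub_quotient_p' G C T :
  G \subset 'N(C) -> p.-Sylow(G) T -> T \subset C -> p^'.-group (G / C).
Proof.
move=> nCG sylT sTC.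
have : p.-Sylow(G / C) (T / C).
  exact: quotient_pHall (subset_trans (pHall_sub sylT) nCG) sylT.
by rewrite (quotientS1 sTC) => /and3P[_ _]; rewrite indexg1.
Qed.

Lemma pgroup_sub_quotient_p' G C T :
    G \subset 'N(C) -> p^'.-group (G / C) -> T \subset G -> p.-group T ->
  T \subset C.
Proof.
move=> nCG p'GC sTG pT; rewrite -quotient_sub1 ?(subset_trans sTG) //.
rewrite -(coprime_TIg (_ : coprime #|T / C| #|G / C|)).
  by rewrite subsetI subxx quotientS.
by apply: pnat_coprime p'GC; apply: quotient_pgroup.
Qed.

End QuotientPrime.

(** * Action of one factor on a Sylow subgroup of a normal subgroup *)

Section CentraliseSylow.

Variables (gT : finGroupType) (p q : nat).
Implicit Types (A B C G H K N P R T Y : {group gT}).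

Lemma leq_index_sub G K H : K \subset G -> H \subset G -> #|K : H| <= #|G : H|.
Proof.
move=> sKG sHG; rewrite -(leq_pmul2l (cardG_gt0 H)) (Lagrange sHG) LagrangeMl.
by rewrite subset_leq_card // mul_subG.
Qed.

(** By the Frattini argument [G = N * 'N_G(P)], and ['N_G(P)] normalises both [N] and ['C_G(P)]. *)
Lemma join_cent_Sylow_normal G N P :
  N <| G -> p.-Sylow(N) P -> N <*> 'C_G(P) <| G.
Proof.
move=> nsNG sylP; have [sNG nNG] := andP nsNG.
have sCG : N <*> 'C_G(P) \subset G by rewrite join_subG sNG subsetIl.
rewrite /normal sCG -{1}(Frattini_arg nsNG sylP) mul_subG //.
  by apply: subset_trans (normG _); apply: joing_subl.
have sNG_P : 'N_G(P) \subset G by exact: subsetIl.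
by rewrite normsY ?normsI ?norms_cent ?subsetIr ?(subset_trans sNG_P) ?normG.
Qed.

(** Induction on [#|Y|]: for [Y0] maximal in the [p]-group [Y], the step from [P :&: A <*> Y0] to
    [P :&: A <*> Y] has index dividing [p], so [cent_index_p] applies. At [Y = 1] the action takes
    place inside [A], which is inert. *)
Lemma mutperm_cent_chain G A B N P T Y :
    mutually_permutable G A B -> N <| G -> p != q -> prime p -> inert p q A ->
    ~~ ab_edge p q B A -> p.-group P -> P \subset N -> q.-group T -> T \subset A ->
    T \subset 'N(P) -> p.-group Y -> Y \subset N :&: B ->
  T \subset 'C(P :&: A <*> Y).
Proof.
move=> mp nsNG npq p_pr inA noAB pP sPN qT sTA nPT.
have [-> | ntT] := eqVneq (T : {set gT}) 1; first by rewrite sub1G.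
have [n] := ubnP #|Y|; elim: n Y => // n IHn Y leYn pY sYV.
have permA (Z : {group gT}) : Z \subset N :&: B -> A <*> Z = A * Z.
  by rewrite subsetI => /andP[_ sZB]; rewrite comm_joingE //; apply: mutperm_commuter mp sZB.
have nT : T \subset 'N(P :&: A <*> Y).
  rewrite normsI //; apply: subset_trans sTA _.
  by apply: subset_trans (normG _); apply: joing_subl.
have [Y1 | ntY] := eqVneq (Y : {set gT}) 1.
  rewrite Y1 joingG1 in nT *; move/inertP: inA; apply=> //.
    exact: subsetIr.
  by apply: pgroupS pP; apply: subsetIl.
have [Y0 maxY0 _] : exists2 M : {group gT}, maximal M Y & 1%G \subset M.
  by case: (maximal_exists (sub1G Y)) => // Y1; rewrite -Y1 eqxx in ntY.
have sY0 := proper_sub (maxgroupp maxY0).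
have iY0 := p_maximal_index pY maxY0.
have sY0V := subset_trans sY0 sYV.
have sAY : A <*> Y0 \subset A <*> Y by rewrite genS // setUS.
apply: (cent_index_p npq p_pr (setIS P sAY)) => //.
- by apply: pgroupS pP; apply: subsetIl.
(* This index is a power of [p] and at most [#|A <*> Y : A <*> Y0|], itself at most [p]; hence it
   divides [p]. *)
- have pk : p.-nat #|P :&: A <*> Y : P :&: A <*> Y0|.
    by apply: pnat_dvd pP; apply: dvdn_trans (dvdn_indexg _ _) (cardSg (subsetIl _ _)).
  have le_p : #|P :&: A <*> Y : P :&: A <*> Y0| <= p.
    have -> : P :&: A <*> Y0 = (P :&: A <*> Y) :&: A <*> Y0.
      by rewrite -setIA (setIidPr sAY).
    rewrite indexgI; apply: leq_trans (leq_index_sub (subsetIr _ _) sAY) _.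
    have -> : #|A <*> Y : A <*> Y0| = #|A <*> Y0 * Y : A <*> Y0|.
      congr #|_ : _|.
      rewrite !permA // -mulgA; congr (_ * _); exact/esym/mulSGid.
    rewrite indexMg -iY0 -indexgI dvdn_leq // indexgS // subsetI sY0.
    exact: joing_subr.
  case/p_natP: pk le_p => // k ->; rewrite -[X in _ <= X]expn1 leq_exp2l ?prime_gt1 //.
  by move=> le_k1; rewrite -[X in _ %| X]expn1 dvdn_exp2l.
- apply: contra noAB => q_p1; apply/and3P; split=> //.
    have [_ pY1 _] := pgroup_pdiv pY ntY.
    rewrite mem_primes p_pr cardG_gt0 (dvdn_trans pY1) // cardSg //.
    by apply: subset_trans sYV (subsetIr _ _).
  have [q_pr qT1 _] := pgroup_pdiv qT ntT.
  by rewrite mem_primes q_pr cardG_gt0 (dvdn_trans qT1) // cardSg.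
apply: IHn => //; last by apply: pgroupS pY.
by apply: leq_trans (proper_card (maxgroupp maxY0)) _; rewrite -ltnS.
Qed.

(* A Sylow [p]-subgroup of [(N :&: A) * Y], with [Y] a Sylow [p]-subgroup of [N :&: B], is
   Sylow in [N]; the [A]-invariant chain of subgroups [(N :&: A) * Z], [Z \subset Y], controls
   the action of [A] on it. *)
Lemma mutperm_sub_join_cent G A B N P T :
    mutually_permutable G A B -> N <| G -> (N :&: A) * (N :&: B) = N ->
    p != q -> prime p -> inert p q A -> ~~ ab_edge p q B A ->
    p.-Sylow(N) P -> q.-group T -> T \subset A ->
  T \subset N <*> 'C_G(P).
Proof.
move=> mp nsNG defN npq p_pr inA noAB sylP qT sTA.
have [sAG sBG] := mutperm_sub mp; have [sNG nNG] := andP nsNG.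
have [Y sylY] := Sylow_exists p (N :&: B); have [sYV pY _] := and3P sylY.
have [sYN sYB] := subsetIP sYV.
have cAY : commute A Y by exact: mutperm_commuter mp sYB.
pose K := (A <*> Y)%G; pose H := (N :&: K)%G.
have eK : K :=: A * Y by exact: comm_joingE.
have eH : H :=: (N :&: A) * Y by rewrite /= [A <*> Y]eK group_modr.
have sKG : K \subset G by rewrite join_subG sAG (subset_trans sYB).
have nsHK : H <| K.
  by rewrite /normal subsetIr normsI ?normG // (subset_trans sKG).
(* [N = H * (N :&: B)] and [H] contains the Sylow subgroup [Y] of [N :&: B], so [H] has index prime
   to [p] in [N]. *)
have sylS R : p.-Sylow(H) R -> p.-Sylow(N) R.
  case/and3P=> sRH pR p'R.
  have sHN : H \subset N by exact: subsetIl.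
  have sRN := subset_trans sRH sHN.
  apply/and3P; split=> //; rewrite -(Lagrange_index sHN sRH) pnatM p'R andbT.
  have <- : H * (N :&: B) = N.
    apply/eqP; rewrite eqEsubset mul_subG ?subsetIl //= -{1}defN mulSg // eH mulG_subl //.
  rewrite indexMg -indexgI; case/and3P: sylY => _ _; apply: pnat_dvd.
  apply: indexgS; rewrite subsetI sYV /= eH; exact: mulG_subr.
have [P0 sylP0] := Sylow_exists p H.
have [T0 sylT0] := Sylow_exists q 'N_K(P0).
have sAK : A \subset K by exact: joing_subl.
have [TA sylTA] := Sylow_exists q A.
(* [#|K : A|] divides [#|Y|], a power of [p]. Hence some conjugate in [K] of the Sylow [q]-subgroup
   [T0] of ['N_K(P0)] lies in [A]. *)
have sylTA' : q.-Sylow(K) TA.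
  have [sTAA qTA q'TA] := and3P sylTA.
  rewrite /pHall (subset_trans sTAA) // qTA -(Lagrange_index sAK sTAA) pnatM q'TA andbT.
  rewrite eK indexMg; apply: pnat_dvd (dvdn_indexg _ _) _.
  by apply: sub_in_pnat pY => r _ /eqnP->; rewrite !inE.
have [sT0 qT0 _] := and3P sylT0; have [sT0K nP0T0] := subsetIP sT0.
have [g Kg sT0g] := Sylow_Jsub sylTA' sT0K qT0.
pose P1 := (P0 :^ g)%G; pose T1 := (T0 :^ g)%G.
have sylP1 : p.-Sylow(H) P1.
  by rewrite -(normsP (normal_norm nsHK) g Kg) pHallJ2.
have sylT1 : q.-Sylow('N_K(P1)) T1.
  by rewrite /= normJ -{1}(conjGid Kg) -conjIg pHallJ2.
have sT1A : T1 \subset A by apply: subset_trans sT0g (pHall_sub sylTA).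
have nP1T1 : T1 \subset 'N(P1) by rewrite normJ conjSg.
have sylP1N := sylS _ sylP1.
have cP1T1 : T1 \subset 'C(P1).
  have <- : P1 :&: A <*> Y = P1.
    by apply/setIidPl; apply: subset_trans (pHall_sub sylP1) (subsetIr _ _).
  have [sP1N pP1 _] := and3P sylP1N.
  apply: mutperm_cent_chain mp nsNG npq p_pr inA noAB pP1 sP1N _ sT1A nP1T1 pY sYV.
  exact: pHall_pgroup sylT1.
have [y Ny ->] := Sylow_trans sylP1N sylP.
have Gy := subsetP sNG y Ny.
have nsC := join_cent_Sylow_normal nsNG sylP1N.
set C := N <*> 'C_G(P1) in nsC.
have -> : N <*> 'C_G(P1 :^ y) = C.
  rewrite -[RHS](normsP (normal_norm nsC) y Gy) conjYg (conjGid Ny).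
  by rewrite conjIg (conjGid Gy) centJ.
have sNC : N \subset C by exact: joing_subl.
have nCK : K \subset 'N(C) := subset_trans sKG (normal_norm nsC).
(* By the Frattini argument [K = H * 'N_K(P1)] with [H] inside [C], and [C] contains [T1], a Sylow
   [q]-subgroup of ['N_K(P1)]. *)
have q'KC : q^'.-group (K / C).
  have -> : K / C = 'N_K(P1) / C.
    rewrite -{1}(Frattini_arg nsHK sylP1) quotientMl; last first.
      exact: subset_trans (normal_sub nsHK) nCK.
    by rewrite quotientS1 ?mul1g // (subset_trans _ sNC) // subsetIl.
  apply: (Sylow_sub_quotient_p' (C := [group of C]) _ sylT1).
    by apply: subset_trans nCK; apply: subsetIl.
  apply: subset_trans (joing_subr _ _).
  by rewrite subsetI cP1T1 (subset_trans sT1A).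
exact: (pgroup_sub_quotient_p' (C := [group of C]) nCK q'KC (subset_trans sTA sAK)).
Qed.

End CentraliseSylow.

(** * Edges of [GammaAB] and reduction to the two factors *)

Section Edges.

Variables (gT : finGroupType) (p q : nat).
Implicit Types (A B C G H K N P R T Y : {group gT}).

Lemma ab_edge_quotient G A B N :
  ab_edge p q (A / N) (B / N) -> ab_edge p q A B.
Proof.
case/and3P=> pA qB q1; apply/and3P; split=> //.
  exact: pi_of_dvd (dvdn_quotient _ _) (cardG_gt0 _) _ pA.
exact: pi_of_dvd (dvdn_quotient _ _) (cardG_gt0 _) _ qB.
Qed.

Lemma ab_edgeS A B A1 B1 :
  A1 \subset A -> B1 \subset B -> ab_edge p q A1 B1 -> ab_edge p q A B.
Proof.
move=> sA sB /and3P[pA qB q1]; apply/and3P; split=> //.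
  exact: pi_of_dvd (cardSg sA) (cardG_gt0 _) _ pA.
exact: pi_of_dvd (cardSg sB) (cardG_gt0 _) _ qB.
Qed.

Lemma mutperm_pi G A B r :
  mutually_permutable G A B -> (r \in \pi(G)) = (r \in \pi(A)) || (r \in \pi(B)).
Proof.
move=> mp; have [sAG sBG] := mutperm_sub mp; have [defG _ _] := mp.
apply/idP/orP=> [|[]]; try exact: pi_of_dvd (cardSg _) (cardG_gt0 _) _.
rewrite !mem_primes !cardG_gt0 /= => /andP[r_pr rG]; rewrite r_pr /=.
by apply/orP; rewrite -Euclid_dvdM // mul_cardG defG dvdn_mulr.
Qed.

(** [#|N <*> A : A|] divides both [#|N|], a power of [p], and [#|G : A|], a divisor of [#|B|], which
    is prime to [p]. *)
Lemma mutperm_pnormal_sub G A B N :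
  mutually_permutable G A B -> N <| G -> p.-group N -> p \notin \pi(B) -> N \subset A.
Proof.
move=> mp /andP[sNG nNG] pN p'B; have [sAG sBG] := mutperm_sub mp; have [defG _ _] := mp.
have nNA := subset_trans sAG nNG.
have sNAG : N <*> A \subset G by rewrite join_subG sNG.
apply: subset_trans (joing_subl N A) _; rewrite -indexg_eq1.
apply/eqP/(@pnat_1 p).
  rewrite /= norm_joinEr // -(normC nNA) indexMg.
  exact: pnat_dvd (dvdn_indexg _ _) pN.
apply: pnat_dvd (indexSg (joing_subr N A) sNAG) _.
rewrite -defG indexMg.
by apply: pnat_dvd (dvdn_indexg _ _) _; rewrite -[_.-nat _]/(p^'.-group B) p'groupEpi.
Qed.

(** If [q] does not divide [#|B|], it divides [#|A|], and then [p] divides [#|B|], since otherwise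
    [N] would be contained in [A]. *)
Lemma ab_edge_cyclic_normal G A B N :
    mutually_permutable G A B -> N <| G -> #|N| = p -> prime p ->
    N :&: A = 1 -> p \in \pi(A) -> q \in \pi(G) -> q \in \pi(p.-1) ->
  ab_edge p q A B || ab_edge p q B A.
Proof.
move=> mp nsNG oN p_pr tiNA pA qG qp1; rewrite /ab_edge pA qp1 !andbT /=.
apply/norP=> -[q'B]; move: qG; rewrite (mutperm_pi _ mp) (negPf q'B) orbF => ->.
rewrite andbT => p'B; have := mutperm_pnormal_sub mp nsNG _ p'B.
rewrite /pgroup oN pnat_id // => /(_ isT)/setIidPl; rewrite tiNA => N1.
by rewrite -oN -N1 cards1 in p_pr.
Qed.

Lemma mutperm_cent_prime_normal G A B N T :
    mutually_permutable G A B -> N <| G -> #|N| = p -> prime p ->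
    N :&: A = 1 -> N :&: B = 1 -> ~~ ab_edge p q A B -> ~~ ab_edge p q B A ->
    T \subset G -> q.-group T ->
  T \subset 'C(N).
Proof.
move=> mp nsNG oN p_pr tiNA tiNB noAB noBA sTG qT.
have [-> | ntT] := eqVneq (T : {set gT}) 1; first by rewrite sub1G.
have [q_pr qT1 _] := pgroup_pdiv qT ntT.
apply: (cent_prime_order oN p_pr _ qT).
  exact: subset_trans sTG (normal_norm nsNG).
apply/negP=> qp1.
have qG : q \in \pi(G) by rewrite mem_primes q_pr cardG_gt0 (dvdn_trans qT1) // cardSg.
have : p \in \pi(G) by rewrite mem_primes p_pr cardG_gt0 -oN cardSg // normal_sub.
rewrite (mutperm_pi _ mp) => /orP[pA | pB].
  have := ab_edge_cyclic_normal mp nsNG oN p_pr tiNA pA qG qp1.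
  by rewrite (negPf noAB) (negPf noBA).
have := ab_edge_cyclic_normal (mutperm_sym mp) nsNG oN p_pr tiNB pB qG qp1.
by rewrite (negPf noAB) (negPf noBA).
Qed.

(** [G / C] is the product of [A / C] and [B / C], both of order prime to [q]. *)
Lemma mutperm_pgroup_sub G A B C T :
    mutually_permutable G A B -> C <| G ->
    (forall S : {group gT}, q.-group S -> S \subset A -> S \subset C) ->
    (forall S : {group gT}, q.-group S -> S \subset B -> S \subset C) ->
    T \subset G -> q.-group T ->
  T \subset C.
Proof.
move=> mp /andP[sCG nCG] inA inB sTG qT; have [sAG sBG] := mutperm_sub mp.
have q'AC (X : {group gT}) : X \subset G ->
    (forall S : {group gT}, q.-group S -> S \subset X -> S \subset C) -> q^'.-group (X / C).
  move=> sXG inX; have [S sylS] := Sylow_exists q X.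
  apply: (Sylow_sub_quotient_p' (subset_trans sXG nCG) sylS).
  exact: inX (pHall_pgroup sylS) (pHall_sub sylS).
apply: (pgroup_sub_quotient_p' nCG _ sTG qT).
have [defG _ _] := mp; rewrite -[X in X / C]defG quotientMl ?(subset_trans sAG) //.
by rewrite pgroupM !q'AC.
Qed.

(* Modulo ['C(R)], the normaliser of [R] in [N * 'C_G(P)] coincides with that in [N]. *)
Lemma inert_join_cent G N P R T :
    N <| G -> inert p q N -> P \subset N -> R \subset P -> p.-group R -> q.-group T ->
    T \subset N <*> 'C_G(P) -> T \subset 'N(R) ->
  T \subset 'C(R).
Proof.
move=> nsNG /inertP inN sPN sRP pR qT sT nRT; have [sNG nNG] := andP nsNG.
have sCR : 'C_G(P) \subset 'C(R) := subset_trans (subsetIr _ _) (centS sRP).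
have sCN : 'C_G(P) \subset 'N(N) := subset_trans (subsetIl _ _) nNG.
have sCNR : 'C_G(P) \subset 'N(R) := subset_trans sCR (cent_sub R).
pose L := ('C_G(P) <*> 'N_N(R))%G.
have nRL : L \subset 'N('C(R)).
  by rewrite norms_cent // join_subG sCNR subsetIr.
have sTL : T \subset L.
  apply: (@subset_trans _ _ ('C_G(P) * 'N_N(R))); last first.
    by rewrite mul_subG ?joing_subl ?joing_subr.
  rewrite group_modl // subsetI nRT andbT.
  by rewrite norm_joinEr // -(normC sCN) in sT.
apply: (pgroup_sub_quotient_p' nRL _ sTL qT).
have [S sylS] := Sylow_exists q 'N_N(R).
have -> : L / 'C(R) = 'N_N(R) / 'C(R).
  rewrite quotientY ?(subset_trans _ nRL) ?joing_subl ?joing_subr //.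
  by rewrite (quotientS1 sCR) joing1G.
apply: (Sylow_sub_quotient_p' _ sylS); first by apply: subset_trans nRL; apply: joing_subr.
have [sSN nSR] := subsetIP (pHall_sub sylS).
exact: inN (subset_trans sRP sPN) sSN pR (pHall_pgroup sylS) nSR.
Qed.

End Edges.

Lemma mutperm_inert (gT : finGroupType) (p q : nat) (G A B : {group gT}) :
    mutually_permutable G A B -> p != q -> prime p -> inert p q A -> inert p q B ->
    ~~ ab_edge p q A B -> ~~ ab_edge p q B A ->
  inert p q G.
Proof.
move=> mp npq p_pr; have [n] := ubnP #|G|.
elim: n => // n IHn in gT G A B mp * => leGn inA inB noAB noBA.
have [sAG sBG] := mutperm_sub mp; have mp' := mutperm_sym mp.
have [G1 | ntG] := eqVneq (G : {set gT}) 1.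
  by apply/inertP=> R T; rewrite G1 => _ sT _ _ _; apply: subset_trans sT (sub1G _).
have [N minN sNG] := minnormal_exists ntG (normG G).
have [/andP[ntN nNG] _] := mingroupP minN.
have nsNG : N <| G by apply/andP.
have inGN : inert p q (G / N).
  apply: (IHn _ _ (A / N)%G (B / N)%G); first exact: mutperm_quotient.
  - by apply: leq_trans (ltn_quotient ntN sNG) _; rewrite -ltnS.
  - exact: inert_quotient (subset_trans sAG nNG) inA.
  - exact: inert_quotient (subset_trans sBG nNG) inB.
  - by apply: contra noAB; apply: ab_edge_quotient.
  by apply: contra noBA; apply: ab_edge_quotient.
(* By induction [T] acts trivially on the image of [R] in [G / N], so [[~: R, T]] lies in [N];
   coprime action reduces the claim to subgroups [R] of [N]. *)
suff inN (R T : {group gT}) : R \subset N -> T \subset G -> p.-group R -> q.-group T ->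
    T \subset 'N(R) -> T \subset 'C(R).
- apply/inertP=> R T sRG sTG pR qT nRT.
  have sRT : [~: R, T] \subset R by rewrite commg_subl.
  apply: coprime_cent_comm (pq_coprime npq pR qT) (pgroup_sol pR) _ => //.
  apply: inN => //; last exact: commg_normr.
    rewrite /= commGC -quotient_cents2 ?(subset_trans sRG) ?(subset_trans sTG) //.
    move/inertP: inGN; apply; rewrite ?quotientS ?quotient_pgroup //.
    exact: quotient_norms.
  exact: pgroupS pR.
move=> sRN sTG pR qT nRT.
case: (mutperm_minnormal mp minN sNG) => [[tiNA tiNB] | defN].
  have [-> | ntR] := eqVneq (R : {set gT}) 1; first by rewrite cents1.
  have N_pr := mutperm_minnormal_prime mp minN sNG tiNA tiNB.
  have [_ pR1 _] := pgroup_pdiv pR ntR.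
  have oN : #|N| = p.
    by apply/esym/eqP; rewrite -dvdn_prime2 // (dvdn_trans pR1) ?cardSg.
  apply: subset_trans (centS sRN).
  exact: mutperm_cent_prime_normal mp nsNG oN p_pr tiNA tiNB noAB noBA sTG qT.
(* If [N = G], then [G] is simple and equals one of the factors; otherwise the induction applies to
   [N = (N :&: A) * (N :&: B)]. *)
have inNN : inert p q N.
  have [eNG | neNG] := eqVneq (N : {set gT}) G.
    have simG : simple G by rewrite /simple -{1}eNG.
    have -> : N = G by apply: val_inj.
    by case: (mutperm_simple mp simG) => /val_inj <-.
  have := mutperm_setI mp defN; move/IHn; apply.
  - by apply: leq_trans (proper_card _) _; last exact: leGn; rewrite properEneq neNG.
  - exact: inertS (subsetIr _ _) inA.
  - exact: inertS (subsetIr _ _) inB.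
  - by apply: contra noAB; apply: ab_edgeS; apply: subsetIr.
  by apply: contra noBA; apply: ab_edgeS; apply: subsetIr.
have [P sylP sRP] := Sylow_superset sRN pR.
have nsC := join_cent_Sylow_normal nsNG sylP.
apply: (inert_join_cent nsNG inNN (pHall_sub sylP) sRP pR qT _ nRT).
apply: (mutperm_pgroup_sub mp nsC _ _ sTG qT) => S qS sS.
  exact: mutperm_sub_join_cent mp nsNG defN npq p_pr inA noBA sylP qS sS.
apply: mutperm_sub_join_cent mp' nsNG _ npq p_pr inB noAB sylP qS sS.
by rewrite -(mutperm_setI_commute N mp).
Qed.

(** * Hawkes edges *)

(* For [p != q], [free p q G] says that [(p, q)] is not an edge of the Hawkes graph:
   ['O_{p^', p}(G) / 'O_p^'(G)] is a [p]-group and so does not affect the prime [q]. *)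
Definition free (gT : finGroupType) (p q : nat) (G : {group gT}) : bool :=
  q^'.-group (G / 'O_p^'(G)).

Section Free.

Variables (gT : finGroupType) (p q : nat).
Implicit Types (G H K N R T : {group gT}).

Lemma freeP G K : K <| G -> p^'.-group K -> q^'.-group (G / K) -> free p q G.
Proof.
move=> nsKG p'K; rewrite /free /pgroup !card_quotient ?gFnorm ?normal_norm //=.
by apply: pnat_dvd; apply/indexgS/pcore_max.
Qed.

End Free.

Section FreeTheory.

Variables (gT : finGroupType) (p q : nat).
Implicit Types (G H K N R T : {group gT}).

Lemma free_sub_pcore G T : free p q G -> T \subset G -> q.-group T -> T \subset 'O_p^'(G).
Proof. by move=> frG; apply: (pgroup_sub_quotient_p' (gFnorm _ _) frG). Qed.

(** ['O_p^'(G)] contains [T], so [[~: R, T]] lies both in it and in the [p]-group [R]. *)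
Lemma free_inert G : free p q G -> inert p q G.
Proof.
move=> frG; apply/inertP=> R T sRG sTG pR qT nRT.
have sTO := free_sub_pcore frG sTG qT.
rewrite centsC; apply/commG1P/trivgP.
have tiRO : R :&: 'O_p^'(G) = 1.
  by apply: coprime_TIg; apply: pnat_coprime pR (pcore_pgroup _ _).
rewrite -tiRO subsetI commg_subl nRT /=.
apply: subset_trans (commgS _ sTO) _; rewrite commg_subr.
exact: subset_trans sRG (gFnorm _ _).
Qed.

Lemma free_quotient G K : G \subset 'N(K) -> free p q G -> free p q (G / K).
Proof.
move=> nKG frG; apply: (@freeP _ _ _ _ ('O_p^'(G) / K)%G).
- exact: quotient_normal (pcore_normal _ _).
- exact: quotient_pgroup (pcore_pgroup _ _).
have nKO : 'O_p^'(G) \subset 'N(K) by apply: subset_trans nKG; apply: pcore_sub.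
rewrite /pgroup card_quotient; last first.
  by apply: normal_norm; apply: quotient_normal (pcore_normal _ _).
apply: pnat_dvd (index_quotient _) _; first by apply: subset_trans nKG; apply: subsetIl.
by rewrite -card_quotient ?gFnorm.
Qed.

Lemma free_p'_quotient G N : N <| G -> p^'.-group N -> free p q (G / N) -> free p q G.
Proof.
move=> nsNG p'N; rewrite /free pquotient_pcore // /pgroup.
have sNO : N \subset 'O_p^'(G) by apply: pcore_max.
have nsO : 'O_p^'(G) <| G by apply: pcore_normal.
by rewrite (card_isog (third_isog sNO nsNG nsO)).
Qed.

(* The Sylow [p]-subgroup of the preimage of ['O_p^'(G / N)] in ['C_G(N)] lies in [N], hence is
   central there, and so has a normal complement. *)
Lemma free_cent_quotient G N :
    p != q -> N <| G -> free p q (G / N) -> q^'.-group (G / 'C_G(N)) ->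
  free p q G.
Proof.
move=> npq nsNG frGN q'C; have [sNG nNG] := andP nsNG.
have [K1 defK1 sNK1 nsK1] := inv_quotientN nsNG (pcore_normal p^' (G / N)).
have [sK1G nK1G] := andP nsK1.
have nsCG : 'C_G(N) <| G by rewrite /normal subsetIl normsI ?normG ?norms_cent.
pose K2 := (K1 :&: 'C_G(N))%G.
have nsK2 : K2 <| G by apply: normalI.
(* [#|G : K1|] is prime to [q] because [G / N] is free, and [#|K1 : K2|] because [G / 'C_G(N)] is a
   [q^']-group. *)
have q'K2 : q^'.-nat #|G : K2|.
  rewrite -(Lagrange_index sK1G (subsetIl _ _)) /= indexgI pnatM.
  rewrite -!card_quotient ?(subset_trans sK1G (normal_norm nsCG)) //.
  have q'K1C : q^'.-nat #|K1 / 'C_G(N)| by exact: pgroupS (quotientS _ sK1G) q'C.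
  rewrite q'K1C andbT.
  by rewrite -(card_isog (third_isog sNK1 nsNG nsK1)) -defK1.
have sK2C : K2 \subset 'C(N) by rewrite /= setIA subsetIr.
have [S sylS] := Sylow_exists p K2.
have [sSK2 pS _] := and3P sylS.
have sK2K1 : K2 \subset K1 by exact: subsetIl.
have sSN : S \subset N.
  have nNK1 := subset_trans sK1G nNG.
  apply: (pgroup_sub_quotient_p' nNK1 _ (subset_trans sSK2 sK2K1) pS).
  by rewrite -defK1 pcore_pgroup.
have cSK2 : K2 \subset 'C(S) := subset_trans sK2C (centS sSN).
have nsS : S <| K2 by rewrite /normal sSK2 cents_norm.
have /splitsP[K /complP[tiSK defK2]] := SchurZassenhaus_split (pHall_Hall sylS) nsS.
have sKK2 : K \subset K2 by rewrite -defK2 mulG_subr.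
have nKK2 : S * K \subset 'N(K).
  rewrite mul_subG ?normG // cents_norm // centsC; exact: subset_trans sKK2 cSK2.
rewrite defK2 in nKK2.
have nsK : K <| K2 by apply/andP.
have oK2 : #|K2| = (#|S| * #|K|)%N by rewrite -defK2 TI_cardMg.
have oK : #|K2 : K| = #|S| by rewrite -divgS // oK2 mulnK.
have p'K : p^'.-group K.
  by case/and3P: sylS => _ _; rewrite -divgS // oK2 mulKn.
have sKO : K \subset 'O_p^'(K2) by exact: pcore_max.
have sOK2 : 'O_p^'(K2) \subset K2 by exact: pcore_sub.
apply: (@freeP _ _ _ _ 'O_p^'(K2)%G).
- exact: gFnormal_trans nsK2.
- exact: pcore_pgroup.
rewrite /pgroup card_quotient; last by apply: normal_norm; apply: gFnormal_trans nsK2.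
rewrite -(Lagrange_index (normal_sub nsK2) sOK2) pnatM q'K2 /=.
apply: pnat_dvd (indexgS _ sKO) _; rewrite oK.
by apply: sub_in_pnat pS => r _ /eqnP->; rewrite !inE.
Qed.

End FreeTheory.

(** * Nonabelian simple factors of minimal normal subgroups *)

Section SimpleFactors.

Variable gT : finGroupType.
Implicit Types (A B G H K N S T U X : {group gT}).

Lemma simple_nonabelian_der1 S : simple S -> ~~ abelian S -> S^`(1) = S.
Proof.
case/simpleP=> _ simS nabS; case: (simS _ (der_normal 1 S)) => // S1.
by case/negP: nabS; rewrite (sameP derG1P eqP) S1.
Qed.

(* The elements normalising all subgroups of [S] form a group normalised by [S] which meets [S]
   trivially, as otherwise all cyclic subgroups of [S] would be normal. *)
Lemma cent_norm_all_subgroups S X :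
    simple S -> ~~ abelian S -> (forall H, H \subset S -> X \subset 'N(H)) ->
  X \subset 'C(S).
Proof.
move=> /simpleP[ntS simS] nabS nSX.
pose K := (\bigcap_(H : {group gT} | H \subset S) 'N(H))%G.
have sXK : X \subset K by apply/bigcapsP=> H; apply: nSX.
have sKN H : H \subset S -> K \subset 'N(H) by move=> sHS; apply: bigcap_inf.
have nKS : S \subset 'N(K).
  apply/subsetP=> s Ss; rewrite inE; apply/bigcapsP=> H sHS.
  by rewrite sub_conjg -normJ sKN // conj_subG ?groupV.
have nsKS : K :&: S <| S by rewrite /normal subsetIr normsI ?normG.
suff tiKS : K :&: S = 1.
  apply: subset_trans sXK _; apply/commG1P/trivgP; rewrite -tiKS subsetI.
  by rewrite commg_subl nKS commg_subr sKN.
case: (simS _ nsKS) => // /setIidPr sSK.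
have [s Ss nts] := trivgPn _ ntS.
have sS : <[s]> \subset S by rewrite cycle_subG.
have nsS : <[s]> <| S by rewrite /normal sS (subset_trans sSK) ?sKN.
case: (simS _ nsS) => [/eqP | eS]; first by rewrite cycle_eq1 (negPf nts).
by rewrite -eS cycle_abelian in nabS.
Qed.

Lemma simple_normal_minnormal S N : simple S -> S <| N -> minnormal S N.
Proof.
case/simpleP=> ntS simS /andP[sSN nSN]; apply/mingroupP; rewrite ntS nSN.
split=> // H /andP[ntH nHN] sHS.
have nsHS : H <| S by rewrite /normal sHS (subset_trans sSN).
by case: (simS _ nsHS) => // H1; rewrite H1 eqxx in ntH.
Qed.

Lemma mutperm_simple_factor G A B S :
    mutually_permutable G A B -> S <| G -> simple S -> ~~ abelian S ->
  S \subset A \/ S \subset B.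
Proof.
move=> mp nsSG simS nabS; have minS := simple_normal_minnormal simS nsSG.
case: (mutperm_minnormal mp minS (normal_sub nsSG)) => [[tiSA tiSB] | defS].
  have := mutperm_minnormal_prime mp minS (normal_sub nsSG) tiSA tiSB.
  by move/prime_cyclic/cyclic_abelian; rewrite (negPf nabS).
case: (mutperm_simple (mutperm_setI mp defS) simS) => eS; [left | right];
  by rewrite -eS subsetIr.
Qed.

(** [K = 'O_p^'(A)] meets [S] trivially, as [p] divides [#|S|]. Since [S] is only subnormal in [A],
    two steps are needed: [[~: K, S]] lies in [K :&: U], which [S] centralises, so [[~: K, S, S] =
    1]; the three subgroup lemma then applies because [S] is perfect. *)
Lemma simple_factor_cent_p' (p : nat) A U S :
    U <| A -> S <| U -> simple S -> ~~ abelian S -> p \in \pi(S) ->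
  'O_p^'(A) \subset 'C(S).
Proof.
move=> nsUA nsSU simS nabS pS; have [ntS simS1] := simpleP _ simS.
have [[sUA nUA] [sSU nSU]] := (andP nsUA, andP nsSU).
have sSA := subset_trans sSU sUA.
pose K := ('O_p^'(A))%G; rewrite -[pcore _ _]/(gval K); have nKA : A \subset 'N(K) by exact: gFnorm.
have tiKS : K :&: S = 1.
  have nsK : K :&: S <| S by rewrite /normal subsetIr normsI ?normG ?(subset_trans sSA).
  case: (simS1 _ nsK) => // /setIidPr sSK.
  by have := pgroupS sSK (pcore_pgroup _ _); rewrite p'groupEpi pS.
have cKU : [~: K :&: U, S] = 1.
  apply/trivgP; rewrite -tiKS /= subsetI andbC commg_subr subIset ?nSU ?orbT //=.
  apply: subset_trans (commSg _ (subsetIl _ _)) _.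
  by rewrite commg_subl (subset_trans sSA).
have sKS : [~: K, S] \subset K :&: U.
  rewrite subsetI commg_subl (subset_trans sSA) //=.
  apply: subset_trans (commgS _ sSU) _; rewrite commg_subr.
  by apply: subset_trans nUA; apply: pcore_sub.
have cKSS : [~: K, S, S] = 1 by apply/trivgP; rewrite -cKU /= commSg.
have cSKS : [~: S, K, S] = 1 by rewrite [[~: S, K]]commGC.
have := three_subgroup cSKS cKSS.
rewrite -derg1 simple_nonabelian_der1 // => /commG1P.
by rewrite centsC.
Qed.

Lemma mutperm_simple_factor_cent G A B N S :
    mutually_permutable G A B -> N <| G -> S <| N -> simple S -> ~~ abelian S ->
    S \subset B -> ~~ (S \subset A) ->
  A \subset 'C(S).
Proof.
move=> mp nsNG nsSN simS nabS sSB nsSA; have [ntS simS1] := simpleP _ simS.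
have [sAG sBG] := mutperm_sub mp; have [sNG nNG] := andP nsNG.
have [sSN nSN] := andP nsSN.
have cAY H : H \subset S -> commute A H.
  by move=> sHS; apply: mutperm_commuter mp (subset_trans sHS sSB).
(* [S :&: A] permutes with its [S]-conjugates, so it lies in a proper normal subgroup of the simple
   group [S]. *)
have tiSA : S :&: A = 1.
  have ltSA : S :&: A \proper S.
    by rewrite properEneq subsetIl andbT; apply: contra nsSA => /eqP/setIidPl.
  have [M [sM ltM nsM]] : exists M : {group gT}, [/\ S :&: A \subset M, M \proper S & M <| S].
    apply: conj_permutable_sub_normal ltSA _ => s Ss.
    have sDS : (S :&: A) :^ s \subset S by rewrite conj_subG ?subsetIl.
    exact: commute_setI (cAY _ sDS) sDS.
  case: (simS1 _ nsM) => [M1 | MS]; first by apply/trivgP; rewrite -M1.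
  by rewrite MS properxx in ltM.
have eY H : H \subset S -> S :&: A <*> H = H.
  by move=> sHS; rewrite (comm_joingE (cAY _ sHS)) -group_modr // tiSA mul1g.
(* If [X] normalises [S], it normalises every subgroup [H = S :&: A <*> H] of [S]. This is used
   first for [N :&: A], and for [A] once [A] is known to normalise [S]. *)
have normAll X : X \subset A -> X \subset 'N(S) -> X \subset 'C(S).
  move=> sXA nSX; apply: cent_norm_all_subgroups => // H sHS.
  rewrite -[H in 'N(H)](eY H sHS) normsI //.
  by apply: subset_trans (normG _); apply: subset_trans sXA (joing_subl _ _).
pose U := (N :&: A)%G.
have cSU : U \subset 'C(S).
  by apply: normAll (subsetIr _ _) (subset_trans (subsetIl _ _) nSN).
have nUA : A \subset 'N(U) by rewrite normsI ?normG ?(subset_trans sAG).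
have eUS : N :&: A <*> S = U * S by rewrite (comm_joingE (cAY _ (subxx S))) -group_modr.
have nUSA : A \subset 'N(U * S).
  rewrite -eUS normsI //; first exact: subset_trans sAG nNG.
  by apply: subset_trans (normG _); apply: joing_subl.
have eW : U <*> S = U * S by rewrite cent_joinEr // centsC.
have defW : 'Z(U) \* S = 'C_(U <*> S)(U).
  rewrite cprodE; last by rewrite centsC; apply: subset_trans cSU; apply: center_sub.
  by rewrite eW /= /center ![_ :&: 'C(_)]setIC group_modr // centsC.
(* [A] normalises [U] and [U * S], hence the centraliser of [U] in [U * S]. This is the central
   product of ['Z(U)] and the perfect group [S], so its derived subgroup is [S]. *)
have nSA : A \subset 'N(S).
  have := der_cprod 1 defW.
  rewrite (simple_nonabelian_der1 simS nabS) (derG1P (center_abelian U)) cprod1g => ->.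
  apply: char_norm_trans (der_char 1 _) _; rewrite normsI ?norms_cent //=.
  by rewrite eW.
exact: normAll.
Qed.

(** [N] is a direct product of images of one simple subgroup under automorphisms, so [#|N|] is a
    power of [#|S|]. *)
Lemma charsimple_simple_normal (p : nat) N :
    charsimple N -> p \in \pi(N) ->
  exists S : {group gT}, [/\ S <| N, simple S & p \in \pi(S)].
Proof.
move=> /[dup] /charsimpleP[ntN _] /charsimple_dprod[H [sHN simH [I sIA defN]]] pN.
have [f If] : exists f, f \in I.
  apply/set0Pn; apply: contraNneq ntN => I0.
  by rewrite -defN I0 big_set0.
have Af := subsetP sIA f If.
pose S := (autm Af @* H)%G.
have eS : S :=: f @: H by rewrite /= morphimEsub // /= autmE.
exists S; split.
- move: defN; rewrite (bigD1 f) //= -eS => /dprod_normal2[] //.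
- by rewrite -(isog_simple (sub_isog sHN (injm_autm Af))).
move: pN; rewrite !mem_primes !cardG_gt0 /= => /andP[p_pr].
rewrite -(bigdprod_card defN) (eq_bigr (fun=> #|S|)) => [|g _]; last first.
  by rewrite eS !card_imset //; apply: perm_inj.
rewrite prod_nat_const p_pr /= Euclid_dvdX //; by case/andP.
Qed.

End SimpleFactors.

Lemma minnormal_abelian_pgroup (gT : finGroupType) (p : nat) (G N : {group gT}) :
  minnormal N G -> abelian N -> p \in \pi(N) -> p.-group N.
Proof.
move=> minN abN; rewrite mem_primes cardG_gt0 /= => /andP[p_pr pN].
have [_ _ /is_abelemP[r r_pr rN]] := minnormal_solvable minN (subxx N) (abelian_sol abN).
have := pgroupP (abelem_pgroup rN) _ p_pr pN.
by rewrite inE => /eqP ->; apply: abelem_pgroup rN.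
Qed.

(** An abelian simple [S] has prime order [r] and lies in ['O_r(N)], which is [N] by minimality; a
    solvable minimal normal subgroup is abelian. *)
Lemma minnormal_simple_nonabelian (gT : finGroupType) (G N S : {group gT}) :
  minnormal N G -> S <| N -> simple S -> ~~ abelian N -> ~~ abelian S.
Proof.
move=> minN nsSN simS; apply: contra => abS.
have [/andP[ntN nNG] minN'] := mingroupP minN.
have [ntS _] := simpleP _ simS.
have S_pr := simple_sol_prime (abelian_sol abS) simS.
have sSO : S \subset 'O_#|S|(N) by rewrite pcore_max // /pgroup pnat_id.
have defN : 'O_#|S|(N) = N.
  apply: minN'; last exact: pcore_sub.
  rewrite gFnorm_trans // andbT; apply: contra ntS => /eqP O1.
  by rewrite -subG1 -O1.
have solN : solvable N by rewrite -defN (pgroup_sol (pcore_pgroup _ _)).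
have [_ _ /is_abelemP[r _ rN]] := minnormal_solvable minN (subxx N) solN.
exact: abelem_abelian rN.
Qed.

Lemma mutperm_free_cent_nonabelian (gT : finGroupType) (p q : nat) (G A B N T : {group gT}) :
    mutually_permutable G A B -> minnormal N G -> N \subset G ->
    (N :&: A) * (N :&: B) = N -> ~~ abelian N -> p \in \pi(N) ->
    free p q A -> q.-group T -> T \subset A ->
  T \subset 'C(N).
Proof.
move=> mp minN sNG defN nabN pN frA qT sTA.
have [/andP[ntN nNG] minN'] := mingroupP minN.
have nsNG : N <| G by apply/andP.
have [sAG sBG] := mutperm_sub mp.
have [S [nsSN simS pS]] := charsimple_simple_normal (minnormal_charsimple minN) pN.
have nabS := minnormal_simple_nonabelian minN nsSN simS nabN.
have [ntS _] := simpleP _ simS.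
pose L := <<class_support S G>>%G.
have sLN : L \subset N.
  by rewrite gen_subG class_support_sub_norm // (normal_sub nsSN).
(* By minimality the [G]-conjugates of [S] generate [N], so each can be treated separately,
   according to whether it lies in [A]. *)
have <- : L :=: N.
  apply: minN' sLN; rewrite norms_gen ?class_support_norm // andbT.
  apply: contra ntS => /eqP L1; rewrite -subG1 -L1 sub_gen //.
  by rewrite class_supportEr (bigcup_max 1) ?group1 ?conjsg1.
rewrite centsC gen_subG class_supportEr; apply/bigcupsP=> g Gg.
rewrite centsC.
have nsSg : (S :^ g)%G <| N.
  by rewrite -(normsP nNG g Gg) normalJ.
have simSg : simple (S :^ g)%G by rewrite -(isog_simple (conj_isog S g)).
have nabSg : ~~ abelian (S :^ g)%G by rewrite abelianJ.
have pSg : p \in \pi((S :^ g)%G) by rewrite /= cardJg.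
have [sSA | nsSA] := boolP ((S :^ g)%G \subset A).
  have sTO := free_sub_pcore frA sTA qT.
  apply: subset_trans sTO _.
  apply: (@simple_factor_cent_p' _ p A (N :&: A)%G (S :^ g)%G) => //.
    by rewrite /normal subsetIr normsI ?normG // (subset_trans sAG).
  by apply: (normalS _ (subsetIl _ _) nsSg); rewrite subsetI sSA (normal_sub nsSg).
case: (mutperm_simple_factor (mutperm_setI mp defN) nsSg simSg nabSg).
  by rewrite subsetI (negPf nsSA) andbF.
rewrite subsetI => /andP[_ sSB].
exact: subset_trans sTA (mutperm_simple_factor_cent mp nsNG nsSg simSg nabSg sSB nsSA).
Qed.

(** An abelian [N] is a [p]-group and thus its own Sylow subgroup, and [N <*> 'C_G(N)] is then just
    ['C_G(N)]. *)
Lemma mutperm_free_cent (gT : finGroupType) (p q : nat) (G A B N T : {group gT}) :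
    mutually_permutable G A B -> minnormal N G -> N \subset G ->
    (N :&: A) * (N :&: B) = N -> p != q -> p \in \pi(N) ->
    free p q A -> ~~ ab_edge p q B A -> q.-group T -> T \subset A ->
  T \subset 'C_G(N).
Proof.
move=> mp minN sNG defN npq pN frA noBA qT sTA.
have [sAG sBG] := mutperm_sub mp.
rewrite subsetI (subset_trans sTA) //=.
have [abN | nabN] := boolP (abelian N); last first.
  exact: mutperm_free_cent_nonabelian mp minN sNG defN nabN pN frA qT sTA.
have [/andP[_ nNG] _] := mingroupP minN.
have nsNG : N <| G by apply/andP.
have p_pr : prime p by move: pN; rewrite mem_primes => /andP[].
have pgN := minnormal_abelian_pgroup minN abN pN.
have sylN : p.-Sylow(N) N by rewrite pHallE subxx part_pnat_id /=.
apply: subset_trans (mutperm_sub_join_cent mp nsNG defN npq p_pr _ noBA sylN qT sTA) _.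
  exact: free_inert.
by rewrite join_subG subsetIr andbT.
Qed.

Lemma mutperm_free (gT : finGroupType) (p q : nat) (G A B : {group gT}) :
    mutually_permutable G A B -> p != q -> prime p -> free p q A -> free p q B ->
    ~~ ab_edge p q A B -> ~~ ab_edge p q B A ->
  free p q G.
Proof.
move=> mp npq p_pr; have [n] := ubnP #|G|.
elim: n => // n IHn in gT G A B mp * => leGn frA frB noAB noBA.
have [sAG sBG] := mutperm_sub mp; have mp' := mutperm_sym mp.
have [G1 | ntG] := eqVneq (G : {set gT}) 1.
  by rewrite /free G1 quotient1 pgroup1.
have [N minN sNG] := minnormal_exists ntG (normG G).
have [/andP[ntN nNG] _] := mingroupP minN.
have nsNG : N <| G by apply/andP.
have frGN : free p q (G / N).
  apply: (IHn _ _ (A / N)%G (B / N)%G); first exact: mutperm_quotient.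
  - by apply: leq_trans (ltn_quotient ntN sNG) _; rewrite -ltnS.
  - exact: free_quotient (subset_trans sAG nNG) frA.
  - exact: free_quotient (subset_trans sBG nNG) frB.
  - by apply: contra noAB; apply: ab_edge_quotient.
  by apply: contra noBA; apply: ab_edge_quotient.
(* If [p] does not divide [#|N|], then [N] lies in ['O_p^'(G)] and the quotient decides; otherwise
   it suffices that [G / 'C_G(N)] is a [q^']-group. *)
have [pN | p'N] := boolP (p \in \pi(N)); last first.
  by apply: free_p'_quotient nsNG _ frGN; rewrite p'groupEpi.
have nsCG : 'C_G(N) <| G by rewrite /normal subsetIl normsI ?normG ?norms_cent.
apply: (free_cent_quotient npq nsNG frGN).
have [T sylT] := Sylow_exists q G; have [sTG qT _] := and3P sylT.
apply: (Sylow_sub_quotient_p' (normal_norm nsCG) sylT).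
case: (mutperm_minnormal mp minN sNG) => [[tiNA tiNB] | defN].
  have N_pr := mutperm_minnormal_prime mp minN sNG tiNA tiNB.
  have oN : #|N| = p.
    by apply/esym/eqP; move: pN; rewrite mem_primes cardG_gt0 => /andP[_]; rewrite dvdn_prime2.
  rewrite subsetI sTG.
  exact: mutperm_cent_prime_normal mp nsNG oN p_pr tiNA tiNB noAB noBA sTG qT.
apply: (mutperm_pgroup_sub mp nsCG _ _ sTG qT) => S qS sS.
  exact: mutperm_free_cent mp minN sNG defN npq pN frA noBA qS sS.
apply: mutperm_free_cent mp' minN sNG _ npq pN frB noAB qS sS.
by rewrite -(mutperm_setI_commute N mp).
Qed.

(** * Graphs *)

Section Graphs.

Variables (gT : finGroupType) (p q : nat).
Implicit Types (A B G S R T P Q : {group gT}).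

Lemma schmidt_pq_neq S : schmidt_pq p q S -> p != q.
Proof.
case=> -[nnilS _] piS _; apply: contra nnilS => /eqP epq.
apply: (@pgroup_nil _ p); apply/pgroupP=> r r_pr rS.
by have := piS r; rewrite mem_primes r_pr cardG_gt0 rS epq orbb !inE => /esym.
Qed.

(** In an inert group a Sylow [q]-subgroup [Q] of [S] centralises the normal Sylow [p]-subgroup [P],
    so [S = P \x Q] would be nilpotent. *)
Lemma schmidt_pq_not_inert G S : S \subset G -> schmidt_pq p q S -> ~~ inert p q G.
Proof.
move=> sSG schS; have npq := schmidt_pq_neq schS.
case: schS => -[nnilS _] piS [P]; rewrite inE => sylP /andP[sPS nPS].
apply: contra nnilS => /inertP inG.
have [Q sylQ] := Sylow_exists q S; have [sQS qQ _] := and3P sylQ.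
have cPQ : Q \subset 'C(P).
  apply: inG => //; [exact: subset_trans sSG | exact: subset_trans sSG | |].
    exact: pHall_pgroup sylP.
  exact: subset_trans nPS.
have hallQ : p^'.-Hall(S) Q.
  rewrite -(eq_in_pHall Q (_ : {in \pi(S), (q : nat_pred) =i p^'})) // => r; rewrite piS !inE.
  by case/orP=> /eqP ->; rewrite ?eqxx ?(negPf npq) // eq_sym (negPf npq).
have tiPQ : P :&: Q = 1 := coprime_TIg (pq_coprime npq (pHall_pgroup sylP) qQ).
have defS : P \x Q = S.
  rewrite dprodE //; apply/eqP; rewrite eqEcard mul_subG //= TI_cardMg //.
  by rewrite (card_Hall sylP) (card_Hall hallQ) partnC.
rewrite (dprod_nil defS) (pgroup_nil (pHall_pgroup sylP)).
exact: pgroup_nil qQ.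
Qed.

(** If [T] does not centralise [R], then [R <*> T] is not nilpotent. A minimal non-nilpotent
    subgroup [S] of it has the normal [p]-subgroup [S :&: R], of index a power of [q]; both primes
    occur, since otherwise [S] would be nilpotent. *)
Lemma not_inert_schmidt_pq G :
  p != q -> ~~ inert p q G -> exists2 S : {group gT}, S \subset G & schmidt_pq p q S.
Proof.
move=> npq; rewrite negb_forall => /existsP[R].
rewrite negb_forall => /existsP[T]; rewrite negb_imply.
case/andP=> /and5P[sRG sTG pR qT nRT] ncRT.
have nnilRT : ~~ nilpotent (R <*> T).
  apply: contra ncRT => nilRT.
  by apply: sub_nilpotent_cent2 nilRT _ _ (pq_coprime npq pR qT);
    rewrite ?joing_subl ?joing_subr.
have [S /mingroupP[nnilS minS] sSRT] :=
  mingroup_exists (gP := fun S : {group gT} => ~~ nilpotent S) nnilRT.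
have sRTG : R <*> T \subset G by rewrite join_subG sRG.
exists S; first exact: subset_trans sSRT sRTG.
have nRS : S \subset 'N(R) by apply: subset_trans sSRT _; rewrite join_subG normG.
pose P := (S :&: R)%G.
have pP : p.-group P by apply: pgroupS pR; apply: subsetIr.
have nsPS : P <| S by rewrite /normal subsetIl normsI ?normG.
have qSP : q.-nat #|S : P|.
  rewrite indexgI -card_quotient //.
  have : q.-group (R <*> T / R).
    by rewrite quotientYidl // quotient_pgroup.
  by apply: pgroupS; apply: quotientS.
have piS r : r \in \pi(S) -> (r == p) || (r == q).
  rewrite /= -(Lagrange (normal_sub nsPS)) pi_ofM ?cardG_gt0 ?indexg_gt0 // inE.
  by case/orP=> rP; [move: (pnatPpi pP rP) | move: (pnatPpi qSP rP)];
    rewrite inE => /eqP ->; rewrite eqxx ?orbT.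
have piS' (r s : nat) : (forall t, t \in \pi(S) -> (t == r) || (t == s)) -> r \in \pi(S).
  move=> pirs; apply: contraR nnilS => r'S; apply: (@pgroup_nil _ s).
  apply/pgroupP=> t t_pr tS; have t_piS : t \in \pi(S) by rewrite mem_primes t_pr cardG_gt0.
  case/orP: (pirs t t_piS) => // /eqP etr.
  by rewrite etr (negPf r'S) in t_piS.
split.
- split=> // H ltHS; apply: contraTT ltHS => nnilH.
  rewrite properE negb_and negbK orbC; apply/orP.
  have [sHS | nsHS] := boolP (H \subset S); last by right.
  by left; rewrite (minS H nnilH sHS).
- move=> r; apply/idP/orP=> [/piS/orP // | [] /eqP ->]; first exact: piS' piS.
  by apply: (piS' q p) => t /piS; rewrite orbC.
exists P => //; rewrite inE pHallE subsetIl /=.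
rewrite -(Lagrange (normal_sub nsPS)) partnM ?cardG_gt0 ?indexg_gt0 // part_pnat_id //.
rewrite [X in (_ * X)%N]part_p'nat ?muln1 //.
by apply: sub_in_pnat qSP => r _ /eqnP ->; rewrite !inE eq_sym.
Qed.

Lemma pi_quotient_pseries G :
  prime q -> p != q -> (q \in \pi(G / 'O_{p^', p}(G))) = ~~ free p q G.
Proof.
move=> q_pr npq.
have sO1 : 'O_p^'(G) \subset 'O_{p^', p}(G).
  by rewrite -pseries1; apply: (pseries_sub_catl [:: p^'] [:: p : nat_pred]).
rewrite -[LHS]negbK -p'groupEpi /free /pgroup !card_quotient ?gFnorm //.
congr (~~ _); rewrite -(Lagrange_index (pseries_sub _ _) sO1) pnatM /=.
have -> : q^'.-nat #|'O_{p^', p}(G) : 'O_p^'(G)|.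
  have := pcore_pgroup p (G / 'O_p^'(G)); rewrite -quotient_pseries2 /pgroup.
  rewrite card_quotient; last by apply: subset_trans (pseries_sub _ _) (gFnorm _ _).
  by apply: sub_in_pnat => r _ /eqnP ->; rewrite !inE.
by rewrite andbT.
Qed.

(** This supplies the condition [p \in \pi(G)] in the edges of [GammaH]: if [p] does not divide
    [#|G|], then ['O_p^'(G) = G]. *)
Lemma not_free_pi G : ~~ free p q G -> p \in \pi(G).
Proof.
apply: contraR => p'G; apply: (freeP (normal_refl G)).
  by rewrite p'groupEpi.
by rewrite trivg_quotient pgroup1.
Qed.

Lemma dvdn_quotient_setI A G (K L : {group gT}) :
    A \subset G -> G \subset 'N(L) -> A \subset 'N(K) -> A :&: L \subset K ->
  #|A / K| %| #|G / L|.
Proof.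
move=> sAG nLG nKA sIK; apply: dvdn_trans (cardSg (quotientS L sAG)).
rewrite (card_quotient nKA) (card_quotient (subset_trans sAG nLG)) -(indexgI A L).
exact: indexgS.
Qed.

Lemma pi_quotient_pseriesS A G :
  A \subset G -> q \in \pi(A / 'O_{p^', p}(A)) -> q \in \pi(G / 'O_{p^', p}(G)).
Proof.
move=> sAG; apply: (pi_of_dvd _ (cardG_gt0 _)).
by apply: dvdn_quotient_setI; rewrite ?gFnorm //= setIC pseriesS.
Qed.

End Graphs.

Theorem theorem3 (gT : finGroupType) (G A B : {group gT}) :
  mutually_permutable G A B ->
  [/\ gsub (gunion (GammaNc A) (GammaNc B)) (GammaNc G),
      gsub (GammaNc G) (gunion (gunion (GammaNc A) (GammaNc B)) (GammaAB G A B)),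
      gsub (gunion (GammaH A) (GammaH B)) (GammaH G) &
      gsub (GammaH G)
        (gunion (gunion (gunion (GammaH A) (GammaH B)) (GammaAB G A B)) (Lgraph G))].
Proof.
move=> mp; have [sAG sBG] := mutperm_sub mp.
have piAB r : (r \in \pi(G)) = (r \in \pi(A)) || (r \in \pi(B)) by exact: mutperm_pi mp.
have piA r : r \in \pi(A) -> r \in \pi(G) by rewrite piAB => ->.
have piB r : r \in \pi(B) -> r \in \pi(G) by rewrite piAB orbC => ->.
split; split=> /=.
- by move=> r [/piA | /piB].
- by move=> p q [] [S sS schS]; exists S => //; apply: subset_trans sS _.
- by move=> r; rewrite piAB => /orP ?; left.
- move=> p q [S sSG schS]; have npq := schmidt_pq_neq schS.
  have p_pr : prime p.
    by case: (schS) => _ /(_ p) + _; rewrite eqxx mem_primes => /andP[].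
  have := schmidt_pq_not_inert sSG schS.
  (* A factor that is not inert contains a Schmidt subgroup of the required type; if both are inert,
     only an edge of [GammaAB] can keep [G] from being inert. *)
  case: (boolP (inert p q A)) => [inA | nA]; last by left; left; apply: not_inert_schmidt_pq.
  case: (boolP (inert p q B)) => [inB | nB]; last by left; right; apply: not_inert_schmidt_pq.
  move=> ninG; right; apply: contraR ninG; rewrite negb_or => /andP[noAB noBA].
  exact: mutperm_inert mp npq p_pr inA inB noAB noBA.
- by move=> r [/piA | /piB].
- by move=> p q [] /andP[pA qA]; rewrite ?(piA _ pA) ?(piB _ pA) /=;
    apply: pi_quotient_pseriesS qA.
- by move=> r; rewrite piAB => /orP ?; do 2 left.
(* Loops belong to [Lgraph]; for [p != q] the Hawkes edges are translated into failures of
   [free]. *)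
move=> p q /andP[pG qG]; have [epq | npq] := eqVneq p q; first by right; rewrite pG.
left; have p_pr : prime p by move: pG; rewrite mem_primes => /andP[].
have q_pr : prime q by move: qG; rewrite mem_primes => /andP[].
rewrite pi_quotient_pseries // in qG; rewrite !pi_quotient_pseries //.
case: (boolP (free p q A)) => [frA | nA]; last by left; left; rewrite (not_free_pi nA).
case: (boolP (free p q B)) => [frB | nB]; last by left; right; rewrite (not_free_pi nB).
right; apply: contraR qG; rewrite negb_or => /andP[noAB noBA].
exact: mutperm_free mp npq p_pr frA frB noAB noBA.
Qed.
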